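(* Let $G$ be a sofic group with finite symmetric generating set $S$, and let $\Gamma_r=(V_r,E_r)$, $V_r^{(0)}\subseteq V_r$ ($r\in\mathbb N$) be the approximating graphs with the isomorphisms $\psi_{v,r}$ described in the context. Let $A$ be a (possibly unbounded) self-adjoint operator in $\ell^2(G)$ such that the space $D_0$ of finitely supported functions is a core for $A$, and such that the matrix elements $a(x,y):=\langle\delta_x,A\delta_y\rangle$ satisfy $a(x,y)=a(xz,yz)$ for all $x,y,z\in G$. Let $A_r$ be the finite-dimensional operators on $\ell^2(V_r)$ built from $A$ as in the context, let $$N_r(\lambda):=\frac{\#\{\text{eigenvalues of }A_r\text{ not larger than }\lambda,\text{ counted with multiplicity}\}}{|V_r|}\qquad(\lambda\in\mathbb R),$$ and let $N(\lambda):=\langle\delta_{\mathrm{id}},E_\lambda\delta_{\mathrm{id}}\rangle$, where $E_\lambda$ is the spectral projection of $A$ on $(-\infty,\lambda]$. Then $$\lim_{r\to\infty}N_r(\lambda)=N(\lambda)$$ at all continuity points $\lambda$ of $N$.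
   Context: Cayley graph: for a group $G$ and a finite symmetric generating set $S$, $\Gamma=\Gamma(G,S)$ has vertex set $G$ and a directed edge from $x$ to $y$ whenever $xy^{-1}\in S$; this edge is labeled by $xy^{-1}$. In any graph the distance of two vertices is the length of a shortest path, ignoring edge directions. $B_r^G$ denotes the closed ball of radius $r$ around the identity $\mathrm{id}$ in $\Gamma$, and $B_\rho^{V_r}(v)$ the closed ball of radius $\rho$ around $v$ in the graph distance of $(V_r,E_r)$. Sofic: $G$ is sofic if for all $\epsilon>0$ and $r\in\mathbb N$ there is a finite directed graph $(V_{r,\epsilon},E_{r,\epsilon})$, edge labeled by $S$, with a subset $V^{(0)}_{r,\epsilon}\subseteq V_{r,\epsilon}$ such that (S1) for all $v\in V^{(0)}_{r,\epsilon}$ the $r$-ball around $v$ (with the induced labeled graph structure) is isomorphic as a labeled graph to $\Gamma|_{B_r^G}$, and (S2) $|V^{(0)}_{r,\epsilon}|\ge(1-\epsilon)|V_{r,\epsilon}|$. Fix a function $\epsilon:\mathbb N\to(0,\infty)$ with $\lim_{r\to\infty}\epsilon(r)=0$ and, for each $r$, (nonempty) graphs as in this definition; write $\Gamma_r=(V_r,E_r):=(V_{r,\epsilon(r)},E_{r,\epsilon(r)})$ and $V_r^{(0)}:=V^{(0)}_{r,\epsilon(r)}$. For $v\in V_r^{(0)}$ let $\psi_{v,r}:B_r^{V_r}(v)\to B_r^G$ be a labeled graph isomorphism with $\psi_{v,r}(v)=\mathrm{id}$. $\delta_x\in\ell^2(G)$ is the Kronecker delta at $x$, and $D_0:=\operatorname{lin}\{\delta_x\mid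 x\in G\}$. The operator $A_r:\ell^2(V_r)\to\ell^2(V_r)$ is $(A_rf)(x):=\sum_{y\in V_r}a_r(x,y)f(y)$, where $a_r(x,y):=a(\psi_{v,r}(x),\psi_{v,r}(y))$ if there exists $v\in V_r^{(0)}$ with $x,y\in B_{r/3}^{V_r}(v)$, and $a_r(x,y):=0$ otherwise. (This value does not depend on the choice of $v$, and $A_r$ is self-adjoint.) *)

(* Defs.v *)
From mathcomp Require Import all_boot all_order all_algebra.
From mathcomp Require Import finmap complex.
From mathcomp Require Import all_classical all_reals all_analysis.

Set Implicit Arguments.
Unset Strict Implicit.
Unset Printing Implicit Defensive.

Import Order.TTheory GRing.Theory Num.Theory.
Import numFieldNormedType.Exports.

Local Open Scope classical_set_scope.
Local Open Scope ring_scope.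
Local Open Scope complex_scope.

(* A directed graph on T, without multiple edges, whose edges carry labels
   in L.  The value of [label] on a non-edge is irrelevant. *)
Record ldigraph (T L : Type) := LDigraph {
  edge : rel T;
  label : T -> T -> L
}.

Definition adjacent (T L : Type) (g : ldigraph T L) : rel T :=
  fun x y => edge g x y || edge g y x.

(* A path v :: p has size p edges. *)
Definition gball (T L : Type) (g : ldigraph T L) (n : nat) (v : T) : set T :=
  [set x | exists p : seq T,
     [/\ path (adjacent g) v p, last v p = x & (size p <= n)%N]].

Definition labeled_iso (T U L : Type) (g : ldigraph T L) (h : ldigraph U L)
    (A : set T) (B : set U) (f : T -> U) : Prop :=
  [/\ set_bij A B f,
      forall x y, A x -> A y -> edge h (f x) (f y) = edge g x y
    & forall x y, A x -> A y -> edge g x y ->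
        label h (f x) (f y) = label g x y].

Definition symmetric_generating (G : groupType) (S : {fset G}) : Prop :=
  (forall s, s \in S -> (s^-1)%g \in S) /\
  (forall x : G, exists2 w : seq G,
     all (fun s => s \in S) w & x = foldr (fun s y => (s * y)%g) 1%g w).

Definition cayley (G : groupType) (S : {fset G}) : ldigraph G G :=
  {| edge := fun x y => (x * y^-1)%g \in S;
     label := fun x y => (x * y^-1)%g |}.

Definition sofic_approximation (R : realType) (G : groupType) (S : {fset G})
    (eps : R) (r : nat) (V : finType) (g : ldigraph V G) (V0 : {set V}) :=
  [/\ (0 < #|V|)%N,
      forall x y, edge g x y -> label g x y \in S,
      forall v, v \in V0 -> exists psi : V -> G,
        labeled_iso g (cayley S) (gball g r v) (gball (cayley S) r 1%g) psi
    & (1 - eps) * #|V|%:R <= #|V0|%:R].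

Definition sofic (R : realType) (G : groupType) (S : {fset G}) : Prop :=
  forall (eps : R) (r : nat), 0 < eps ->
    exists (V : finType) (g : ldigraph V G) (V0 : {set V}),
      sofic_approximation S eps r g V0.

Section ell2.
Variables (R : realType) (G : choiceType).
Local Notation C := R[i].
Implicit Types (f g h : G -> C) (D : set (G -> C)) (A : (G -> C) -> (G -> C)).

Definition sqnorm f : \bar R :=
  \esum_(x in [set: G]) (complex.Re (f x) ^+ 2 + complex.Im (f x) ^+ 2)%:E.

Definition ell2 : set (G -> C) := [set f | (sqnorm f < +oo)%E].

Definition l2norm f : R := Num.sqrt (fine (sqnorm f)).

(* Sums of absolutely summable families, reduced to the nonnegative case. *)
Definition rsum (u : G -> R) : R :=
  fine (\esum_(x in [set: G]) (Num.max (u x) 0)%:E)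
  - fine (\esum_(x in [set: G]) (Num.max (- u x) 0)%:E).

Definition csum (u : G -> C) : C :=
  rsum (fun x => complex.Re (u x)) +i* rsum (fun x => complex.Im (u x)).

(* Linear in the second argument. *)
Definition dot f g : C := csum (fun x => conjc (f x) * g x).

Definition delta (x : G) : G -> C := fun y => (y == x)%:R.

(* The linear span of the functions delta x. *)
Definition D0 : set (G -> C) :=
  [set f | exists (s : seq G) (c : G -> C),
     f = fun y => \sum_(x <- s) c x * delta x y].

(* Operators are given by a domain D and a function A of which only the
   values on D matter. *)
Definition linear_operator D A : Prop :=
  [/\ D `<=` ell2, D 0,
      forall f, D f -> ell2 (A f)
    & forall (c : C) f g, D f -> D g ->
        D (c *: f + g) /\ A (c *: f + g) = c *: A f + A g].

Definition l2dense D : Prop :=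
  forall f (e : R), ell2 f -> 0 < e -> exists2 h, D h & l2norm (f - h) < e.

(* A densely defined linear operator which has the same graph as its
   adjoint. *)
Definition self_adjoint D A : Prop :=
  [/\ linear_operator D A, l2dense D
    & forall f g, ell2 f -> ell2 g ->
        (forall h, D h -> dot (A h) f = dot h g) <-> (D f /\ A f = g)].

(* D1 is dense in D for the graph norm. *)
Definition is_core D A (D1 : set (G -> C)) : Prop :=
  D1 `<=` D /\
  forall f (e : R), D f -> 0 < e ->
    exists h, [/\ D1 h, l2norm (f - h) < e & l2norm (A f - A h) < e].

Definition orthogonal_projection (P : (G -> C) -> (G -> C)) : Prop :=
  [/\ linear_operator ell2 P,
      forall f, ell2 f -> P (P f) = P f
    & forall f g, ell2 f -> ell2 g -> dot (P f) g = dot f (P g)].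

Implicit Type E : set (measurableTypeR R) -> (G -> C) -> (G -> C).

(* mu is the measure B |-> <f, E(B) f>. *)
Definition scalar_spectral_measure E f
    (mu : {measure set (measurableTypeR R) -> \bar R}) : Prop :=
  forall B, measurable B -> mu B = (complex.Re (dot f (E B f)))%:E.

Definition projection_valued_measure E : Prop :=
  [/\ forall B, measurable B -> orthogonal_projection (E B),
      forall f, ell2 f -> E setT f = f,
      forall B1 B2 f, measurable B1 -> measurable B2 -> ell2 f ->
        E (B1 `&` B2) f = E B1 (E B2 f)
    & forall f, ell2 f -> exists mu, scalar_spectral_measure E f mu].

(* E is the spectral measure of the self-adjoint operator A with domain D,
   that is, A is the integral of t dE(t), in the weak sense and with its
   natural domain. *)
Definition spectral_measure D A E : Prop :=
  projection_valued_measure E /\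
  forall f mu, ell2 f -> scalar_spectral_measure E f mu ->
    (D f <-> (\int[mu]_t ((t : R) ^+ 2)%:E < +oo)%E) /\
    (D f -> dot f (A f) = (\int[mu]_t (t : R))%:C).

End ell2.

Definition matrix_element (R : realType) (G : choiceType)
    (A : (G -> R[i]) -> (G -> R[i])) (x y : G) : R[i] :=
  dot (delta R x) (A (delta R y)).

(* Since distances are integers, the closed ball of radius r / 3 is the one of
   radius r %/ 3. *)
Definition approx_element (R : realType) (G : groupType)
    (a : G -> G -> R[i]) (r : nat) (V : finType) (g : ldigraph V G)
    (V0 : {set V}) (psi : V -> V -> G) (x y : V) : R[i] :=
  if [pick v in V0 | (x \in gball g (r %/ 3) v) && (y \in gball g (r %/ 3) v)]
    is Some v then a (psi v x) (psi v y) else 0.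

(* Matrix of the operator f |-> (x |-> \sum_y k x y * f y) on functions on V. *)
Definition kernel_mx (R : realType) (V : finType) (k : V -> V -> R[i]) :
    'M[R[i]]_#|V| :=
  \matrix_(i, j) k (enum_val i) (enum_val j).

(* The roots of the characteristic polynomial, listed with multiplicity. *)
Definition eigenvalues (R : realType) (n : nat) (M : 'M[R[i]]_n) : seq R[i] :=
  sval (closed_field_poly_normal (char_poly M)).

(* In R[i], z <= w means that w - z is a nonnegative real number. *)
Definition eigenvalue_counting (R : realType) (V : finType)
    (k : V -> V -> R[i]) (lambda : R) : R :=
  (count (fun z => z <= lambda%:C) (eigenvalues (kernel_mx k)))%:R / #|V|%:R.

Definition spectral_distribution (R : realType) (G : groupType)
    (E : set (measurableTypeR R) -> (G -> R[i]) -> (G -> R[i]))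
    (lambda : R) : R :=
  complex.Re (dot (delta R 1%g) (E [set t | t <= lambda] (delta R 1%g))).

(* Main.v *)
Require Import Defs.
From HB Require Import structures.
From mathcomp Require Import all_boot all_order all_algebra.
From mathcomp Require Import finmap complex.
From mathcomp Require Import all_classical all_reals all_analysis.
From mathcomp Require Import spectral measurable_realfun.
From mathcomp Require Import ring lra.
Import Order.TTheory GRing.Theory Num.Theory.
Import numFieldNormedType.Exports.
Local Open Scope classical_set_scope.
Local Open Scope ring_scope.
Set Implicit Arguments.
Unset Strict Implicit.
Unset Printing Implicit Defensive.

(* Let mu be the spectral measure of A at delta_1, so that N is its distribution
   function.  Cut a half-line B at distance at least rho from lambda into m
   bounded intervals of width w, with an endpoint t_k each, and split
   E(B) delta_1 into the corresponding orthogonal pieces f_k.  Then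
   |(A - t_k) f_k| <= w |f_k|, and the sum of these errors is at most w sqrt m,
   which tends to 0 when the total length m w is kept fixed.  Since D_0 is a
   core, the f_k may be replaced by finitely supported functions h_k, which can
   be copied around any v in V_r^(0): the copies h_k,v satisfy
   |(A_r - t_k) h_k,v| <= |(A - t_k) h_k| + o(1).
   Let P be the spectral projection of A_r on the side of lambda opposite to B.
   Every eigenvalue in its range is at distance at least rho from t_k, hence
   |P h_k,v| <= |(A_r - t_k) h_k,v| / rho is negligible and
   |P delta_v|^2 <= |delta_1 - sum_k f_k|^2 + o(1) = 1 - mu(B) + o(1).
   The mean of |P delta_v|^2 over v is the proportion of eigenvalues on that
   side, so that B = ]lambda + rho, +oo[ bounds N_r(lambda) above by
   N(lambda + rho) + o(1), and B = ]-oo, lambda - rho] bounds it below by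
   N(lambda - rho) - o(1). *)

(** * Square-summable functions *)

Section RealSums.
Variables (R : realType) (T : choiceType).
Implicit Types u v p q : T -> R.

Definition rsummable u := (\esum_(x in [set: T]) `|u x|%:E < +oo)%E.

Lemma le_rsummable u v : (forall x, `|u x| <= `|v x|) ->
  rsummable v -> rsummable u.
Proof.
by move=> uv; apply: le_lt_trans; apply: le_esum => x _; rewrite lee_fin.
Qed.

Lemma rsummableD u v :
  rsummable u -> rsummable v -> rsummable (fun x => u x + v x).
Proof.
move=> su sv; apply: le_lt_trans (lte_add_pinfty su sv).
rewrite -esumD; do ?by move=> x _; rewrite lee_fin.
by apply: le_esum => x _; rewrite -EFinD lee_fin ler_normD.
Qed.

(** One inequality for positive factors suffices: applied to [c^-1] and [c * p] it gives the
    converse. *)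
Lemma esumZ (c : R) p : 0 <= c -> (forall x, 0 <= p x) ->
  (\esum_(x in [set: T]) (c * p x)%:E = c%:E * \esum_(x in [set: T]) (p x)%:E)%E.
Proof.
suff le (d : R) q : 0 < d -> (forall x, 0 <= q x) ->
    (\esum_(x in [set: T]) (d * q x)%:E <= d%:E * \esum_(x in [set: T]) (q x)%:E)%E.
  rewrite le_eqVlt => /predU1P[<- p0|c0 p0].
    by rewrite mul0e esum1// => x _; rewrite mul0r.
  apply/eqP; rewrite eq_le le//=.
  have := le c^-1 (fun x => c * p x); rewrite invr_gt0 c0.
  move=> /(_ isT) /(_ (fun x => mulr_ge0 (ltW c0) (p0 x))).
  under eq_esum do rewrite mulrA mulVf ?mul1r ?gt_eqF//.
  by rewrite lee_pdivlMl// invrK.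
move=> d0 q0; apply: ge_ereal_sup => _ [X [finX _] <-].
rewrite (eq_fsbigr (fun x => d%:E * (q x)%:E)%E) => [|x _]; last by rewrite EFinM.
rewrite -ge0_mule_fsumr; last by move=> x; rewrite lee_fin.
rewrite lee_pmul2l ?lte_fin//.
by apply: esum_ge; exists X.
Qed.

Lemma rsummableZ (c : R) u : rsummable u -> rsummable (fun x => c * u x).
Proof.
rewrite /rsummable => su; under eq_esum do rewrite normrM.
by rewrite esumZ//; apply: lte_mul_pinfty.
Qed.

Lemma rsummable_nneg p : (forall x, 0 <= p x) ->
  rsummable p = (\esum_(x in [set: T]) (p x)%:E < +oo)%E :> Prop.
Proof.
move=> p0; rewrite /rsummable.
by under eq_esum do rewrite ger0_norm//.
Qed.

Lemma esum_fin p : (forall x, 0 <= p x) -> rsummable p ->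
  (\esum_(x in [set: T]) (p x)%:E)%E \is a fin_num.
Proof.
move=> p0; rewrite rsummable_nneg// => sp.
by rewrite ge0_fin_numE// esum_ge0// => x _; rewrite lee_fin.
Qed.

Lemma rsummable_max u : rsummable u -> rsummable (fun x => Num.max (u x) 0).
Proof.
apply: le_rsummable => x; rewrite ger0_norm ?le_max ?lexx ?orbT//.
by rewrite ge_max normr_ge0 ler_norm.
Qed.

(** Independence of the decomposition: with d = p - q one has max(d, 0) + q = max(-d, 0) + p, an
    identity between nonnegative summable families. *)
Lemma rsum_sub p q : (forall x, 0 <= p x) -> (forall x, 0 <= q x) ->
  rsummable p -> rsummable q ->
  rsum (fun x => p x - q x) = fine (\esum_(x in [set: T]) (p x)%:E)
    - fine (\esum_(x in [set: T]) (q x)%:E).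
Proof.
move=> p0 q0 sp sq; rewrite /rsum.
have spq : rsummable (fun x => p x - q x).
  by apply: rsummableD => //; apply: le_rsummable sq => x; rewrite normrN.
have s1 := rsummable_max spq.
have s2 : rsummable (fun x => Num.max (- (p x - q x)) 0).
  by apply: rsummable_max; apply: le_rsummable spq => x; rewrite normrN.
have m0 w : 0 <= Num.max w (0 : R) by rewrite le_max lexx orbT.
apply/eqP; rewrite subr_eq addrAC eq_sym subr_eq; apply/eqP.
rewrite -!fineD ?esum_fin//; congr fine.
rewrite -!esumD; do ?by move=> x _; rewrite lee_fin.
apply: eq_esum => x _; rewrite -!EFinD; congr EFin.
by case: (leP (p x - q x) 0) => h; case: leP => h2; lra.
Qed.

Lemma rsum_nneg p : (forall x, 0 <= p x) ->
  rsum p = fine (\esum_(x in [set: T]) (p x)%:E).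
Proof.
move=> p0; rewrite /rsum [X in _ - fine X]esum1 ?subr0.
  by under eq_esum do rewrite max_l//.
by move=> x _; rewrite max_r// oppr_le0.
Qed.

(** Positive parts do not add up to the positive part of the sum, but [u + v] is still the
    difference of the added parts, and [rsum_sub] accepts any such decomposition. *)
Lemma rsumD u v : rsummable u -> rsummable v ->
  rsum (fun x => u x + v x) = rsum u + rsum v.
Proof.
move=> su sv.
have m0 (w : R) : 0 <= Num.max w 0 by rewrite le_max lexx orbT.
have sN w : rsummable w -> rsummable (fun x => - w x).
  by apply: le_rsummable => x; rewrite normrN.
have E (w : R) : w = Num.max w 0 - Num.max (- w) 0.
  by case: (leP w 0) => h; case: leP => h2; lra.
transitivity (rsum (fun x => (Num.max (u x) 0 + Num.max (v x) 0)
    - (Num.max (- u x) 0 + Num.max (- v x) 0))).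
  congr rsum; apply/funext => x; rewrite {1}(E (u x)) {1}(E (v x)); lra.
have [s1 s2] := (rsummable_max su, rsummable_max sv).
have [s3 s4] := (rsummable_max (sN _ su), rsummable_max (sN _ sv)).
have a0 (a b : R) : 0 <= a -> 0 <= b -> 0 <= a + b by move=> *; rewrite addr_ge0.
rewrite rsum_sub//; try (by move=> x; apply: a0); try exact: rsummableD.
under eq_esum do rewrite EFinD.
under [X in _ - fine X]eq_esum do rewrite EFinD.
rewrite !esumD; do ?by move=> x _; rewrite lee_fin.
by rewrite !fineD ?esum_fin// /rsum; lra.
Qed.

(** A nonnegative factor passes through both parts; a change of sign exchanges them. *)
Lemma rsumZ (c : R) u : rsummable u -> rsum (fun x => c * u x) = c * rsum u.
Proof.
have m0 (w : R) : 0 <= Num.max w 0 by rewrite le_max lexx orbT.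
have sN w : rsummable w -> rsummable (fun x => - w x).
  by apply: le_rsummable => x; rewrite normrN.
have pos (d : R) w : 0 <= d -> rsummable w -> rsum (fun x => d * w x) = d * rsum w.
  move=> d0 sw.
  have E (y : R) : Num.max (d * y) 0 = d * Num.max y 0 by rewrite maxr_pMr ?mulr0.
  rewrite /rsum; under eq_esum do rewrite E.
  under [X in _ - fine X]eq_esum do rewrite -mulrN E.
  rewrite !esumZ// !fineM ?esum_fin//= ?mulrBr//.
  - by apply: rsummable_max; exact: sN.
  - exact: rsummable_max.
have rN w : rsum (fun x => - w x) = - rsum w.
  rewrite /rsum opprB; congr (_ - _).
  by under eq_esum do rewrite opprK.
move=> su; case: (leP 0 c) => c0; first exact: pos.
have -> : (fun x => c * u x) = (fun x => - (- c * u x)).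
  by apply/funext => x; rewrite mulNr opprK.
by rewrite rN pos ?oppr_ge0 1?ltW// mulNr opprK.
Qed.

Lemma rsum_single (x0 : T) u : (forall x, x != x0 -> u x = 0) ->
  rsum u = u x0.
Proof.
move=> u0.
have E (f : R -> R) : f 0 = 0 -> (forall y, 0 <= f y) ->
    \esum_(x in [set: T]) (f (u x))%:E = (f (u x0))%:E.
  move=> f0 fp; rewrite (esumID [set x0]); last by move=> x _; rewrite lee_fin.
  rewrite setTI esum_set1 ?lee_fin//= esum1 ?adde0// => x [_ /= /eqP xx].
  by rewrite u0// f0.
rewrite /rsum (E (fun y => Num.max y 0)) ?(E (fun y => Num.max (- y) 0)) ?oppr0 ?maxxx//=.
- by case: (leP (u x0) 0) => h; case: leP => h2; lra.
- by move=> y; rewrite le_max lexx orbT.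
- by move=> y; rewrite le_max lexx orbT.
Qed.

End RealSums.

(** The squared modulus with values in [R], in the shape of the summand of [sqnorm]. *)
Definition abs2 (R : realType) (z : R[i]) : R := complex.Re z ^+ 2 + complex.Im z ^+ 2.

Lemma abs2_ge0 (R : realType) (z : R[i]) : 0 <= abs2 z.
Proof. by rewrite addr_ge0 ?sqr_ge0. Qed.

Lemma abs2_0 (R : realType) : abs2 (0 : R[i]) = 0.
Proof. by rewrite /abs2 /= expr0n /= addr0. Qed.

Lemma abs2M (R : realType) (a b : R[i]) : abs2 (a * b) = abs2 a * abs2 b.
Proof. by case: a b => [a1 a2] [b1 b2]; rewrite /abs2 /=; ring. Qed.

Lemma abs2_real (R : realType) (t : R) : abs2 (t%:C)%C = t ^+ 2.
Proof. by rewrite /abs2 /=; ring. Qed.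

Lemma abs2D_le (R : realType) (a b : R[i]) : abs2 (a + b) <= 2 * (abs2 a + abs2 b).
Proof.
case: a b => [a1 a2] [b1 b2]; rewrite /abs2 /=.
have := sqr_ge0 (a1 - b1); have := sqr_ge0 (a2 - b2); rewrite !expr2 => ? ?; lra.
Qed.

(** * The real inner product, the norm and tails of square-summable functions *)

Section Ell2.
Variables (R : realType) (T : choiceType).
Local Notation C := R[i].
Local Notation Re := (@complex.Re R).
Local Notation Im := (@complex.Im R).
Implicit Types f g h : T -> C.

(* Locked, since unification would otherwise unfold it down to a difference. *)
Definition ip f g : R :=
  locked (rsum (fun x => Re (f x) * Re (g x) + Im (f x) * Im (g x))).

Lemma ip_rsum f g :
  ip f g = rsum (fun x => Re (f x) * Re (g x) + Im (f x) * Im (g x)).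
Proof. by rewrite /ip -lock. Qed.

Lemma re_dot f g : Re (dot f g) = ip f g.
Proof.
rewrite /dot /csum /= !ip_rsum; congr rsum; apply/funext => x.
by case: (f x) (g x) => [a b] [c d] /=; ring.
Qed.

Lemma ell2E f : ell2 f = rsummable (fun x => abs2 (f x)) :> Prop.
Proof. by rewrite rsummable_nneg// => x; exact: abs2_ge0. Qed.

Lemma rsummable_ip f g : ell2 f -> ell2 g ->
  rsummable (fun x => Re (f x) * Re (g x) + Im (f x) * Im (g x)).
Proof.
rewrite !ell2E => sf sg; apply: le_rsummable (rsummableD sf sg) => x.
have := abs2_ge0 (f x); have := abs2_ge0 (g x) => g0 f0.
rewrite [leRHS]ger0_norm; last by lra.
move: g0 f0; rewrite /abs2; set a := Re _; set b := Re _; set c := Im _; set d := Im _.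
have := sqr_ge0 (a - b); have := sqr_ge0 (a + b).
have := sqr_ge0 (c - d); have := sqr_ge0 (c + d); rewrite !expr2 => ? ? ? ?.
have := sqr_ge0 a; have := sqr_ge0 b; have := sqr_ge0 c; have := sqr_ge0 d.
by rewrite !expr2 => ? ? ? ? _ _; rewrite ler_norml; apply/andP; split; lra.
Qed.

Lemma ell20 : ell2 (0 : T -> C).
Proof.
rewrite ell2E /rsummable esum1// => x _.
by rewrite abs2_0 normr0.
Qed.

Lemma ell2D f g : ell2 f -> ell2 g -> ell2 (f + g).
Proof.
rewrite !ell2E => sf sg.
apply: le_rsummable (rsummableZ 2 (rsummableD sf sg)) => x.
have := abs2_ge0 (f x); have := abs2_ge0 (g x) => g0 f0.
rewrite ger0_norm ?abs2_ge0// ger0_norm; first exact: abs2D_le.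
by lra.
Qed.

Lemma ell2Z (c : C) f : ell2 f -> ell2 (c *: f).
Proof.
rewrite !ell2E => /(rsummableZ (abs2 c)); congr rsummable.
by apply/funext => x; rewrite -abs2M.
Qed.

Lemma ell2N f : ell2 f -> ell2 (- f).
Proof. by move=> /(ell2Z (-1)); rewrite scaleN1r. Qed.

Lemma ell2B f g : ell2 f -> ell2 g -> ell2 (f - g).
Proof. by move=> sf sg; apply: ell2D => //; exact: ell2N. Qed.

Lemma ell2_sum (I : Type) (s : seq I) (F : I -> T -> C) :
  (forall i, ell2 (F i)) -> ell2 (\sum_(i <- s) F i).
Proof. by move=> sF; apply: big_ind => //; [exact: ell20|exact: ell2D]. Qed.

Lemma ipC f g : ip f g = ip g f.
Proof. by rewrite !ip_rsum; congr rsum; apply/funext => x; ring. Qed.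

Lemma ipDl f g h : ell2 f -> ell2 g -> ell2 h -> ip (f + g) h = ip f h + ip g h.
Proof.
move=> sf sg sh; rewrite !ip_rsum -rsumD; [|exact: rsummable_ip..].
congr rsum; apply/funext => x; rewrite -[(f + g) x]/(f x + g x).
by case: (f x) (g x) (h x) => [? ?] [? ?] [? ?] /=; ring.
Qed.

Lemma ipDr f g h : ell2 f -> ell2 g -> ell2 h -> ip f (g + h) = ip f g + ip f h.
Proof. by move=> sf sg sh; rewrite ipC ipDl// ipC (ipC h). Qed.

Lemma ipZl (c : R) f g : ell2 f -> ell2 g -> ip ((c%:C)%C *: f) g = c * ip f g.
Proof.
move=> sf sg; rewrite !ip_rsum -rsumZ; last exact: rsummable_ip.
congr rsum; apply/funext => x /=.
rewrite /GRing.scale /=.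
by case: (f x) (g x) => [? ?] [? ?] /=; ring.
Qed.

Lemma ipZr (c : R) f g : ell2 f -> ell2 g -> ip f ((c%:C)%C *: g) = c * ip f g.
Proof. by move=> sf sg; rewrite ipC ipZl// ipC. Qed.

Lemma scaleN1C f : ((-1)%:C)%C *: f = - f.
Proof.
by rewrite rmorphN1 scaleN1r.
Qed.

Lemma ipNl f g : ell2 f -> ell2 g -> ip (- f) g = - ip f g.
Proof. by move=> sf sg; rewrite -scaleN1C ipZl// mulN1r. Qed.

Lemma ipBl f g h : ell2 f -> ell2 g -> ell2 h -> ip (f - g) h = ip f h - ip g h.
Proof. by move=> sf sg sh; rewrite ipDl//; [rewrite ipNl|exact: ell2N]. Qed.

Lemma ipBr f g h : ell2 f -> ell2 g -> ell2 h -> ip f (g - h) = ip f g - ip f h.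
Proof. by move=> sf sg sh; rewrite ipC ipBl// ipC (ipC h). Qed.

Lemma ipE f : ip f f = fine (sqnorm f).
Proof.
rewrite !ip_rsum rsum_nneg; first by [].
by move=> x; rewrite -!expr2 addr_ge0 ?sqr_ge0.
Qed.

Lemma ip_ge0 f : 0 <= ip f f.
Proof.
by rewrite ipE fine_ge0// esum_ge0// => x _; rewrite lee_fin abs2_ge0.
Qed.

Lemma l2norm_ge0 f : 0 <= l2norm f.
Proof. exact: sqrtr_ge0. Qed.

Lemma l2norm2 f : l2norm f ^+ 2 = ip f f.
Proof. by rewrite sqr_sqrtr -ipE// ip_ge0. Qed.

Lemma l2normE f : l2norm f = Num.sqrt (ip f f).
Proof. by rewrite ipE. Qed.

Lemma ip_D f g : ell2 f -> ell2 g ->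
  ip (f + g) (f + g) = ip f f + 2 * ip f g + ip g g.
Proof.
move=> sf sg; have sfg := ell2D sf sg.
by rewrite ipDl// !ipDr// (ipC g f); ring.
Qed.

Lemma ip_B f g : ell2 f -> ell2 g ->
  ip (f - g) (f - g) = ip f f - 2 * ip f g + ip g g.
Proof.
move=> sf sg; have sfg := ell2B sf sg.
by rewrite ipBl// !ipBr// (ipC g f); ring.
Qed.

(** The quadratic polynomial t -> |f - t g|^2 is nonnegative. *)
Lemma ip_CS2 f g : ell2 f -> ell2 g -> ip f g ^+ 2 <= ip f f * ip g g.
Proof.
move=> sf sg; have q t : 0 <= ip f f - 2 * t * ip f g + t ^+ 2 * ip g g.
  have := ip_ge0 (f - (t%:C)%C *: g); have stg := ell2Z (t%:C)%C sg.
  by rewrite ip_B// !ipZr// ipZl//; lra.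
have := ip_ge0 g; rewrite le_eqVlt => /predU1P[g0|g0].
  case: (eqVneq (ip f g) 0) => [->|fg0]; first by rewrite -g0 expr2 mul0r mulr0.
  (* For [g] of norm 0 the polynomial is affine, and at this [t] it would equal -1. *)
  have := q ((ip f f + 1) / (2 * ip f g)); rewrite -g0 mulr0 addr0.
  have -> : 2 * ((ip f f + 1) / (2 * ip f g)) * ip f g = ip f f + 1 by field.
  by move=> h; exfalso; lra.
(* The minimum of the quadratic. *)
have := q (ip f g / ip g g).
have -> : ip f f - 2 * (ip f g / ip g g) * ip f g
    + (ip f g / ip g g) ^+ 2 * ip g g = (ip f f * ip g g - ip f g ^+ 2) / ip g g.
  by field; rewrite gt_eqF.
by rewrite pmulr_lge0 ?invr_gt0// subr_ge0.
Qed.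

Lemma ip_CS f g : ell2 f -> ell2 g -> ip f g <= l2norm f * l2norm g.
Proof.
move=> sf sg; rewrite !l2normE -sqrtrM ?ip_ge0//.
apply: le_trans (ler_norm _) _; rewrite -sqrtr_sqr.
by apply: ler_wsqrtr; exact: ip_CS2.
Qed.

Lemma l2normD f g : ell2 f -> ell2 g -> l2norm (f + g) <= l2norm f + l2norm g.
Proof.
move=> sf sg.
rewrite -(@ler_pXn2r _ 2) ?nnegrE ?addr_ge0 ?l2norm_ge0//.
rewrite l2norm2 ip_D// sqrrD !l2norm2 lerD2r lerD2l.
by have := ip_CS sf sg; lra.
Qed.

Lemma l2norm0 : l2norm (0 : T -> C) = 0.
Proof.
rewrite /l2norm /sqnorm esum1 ?sqrtr0// => x _.
by rewrite -/(abs2 _) abs2_0.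
Qed.

Lemma l2normZ (c : C) f : ell2 f -> l2norm (c *: f) = Num.sqrt (abs2 c) * l2norm f.
Proof.
move=> sf; rewrite /l2norm -sqrtrM ?abs2_ge0//; congr Num.sqrt.
rewrite /sqnorm -/(fine _).
have -> : \esum_(x in [set: T]) (Re ((c *: f) x) ^+ 2 + Im ((c *: f) x) ^+ 2)%:E
    = ((abs2 c)%:E * sqnorm f)%E.
  rewrite /sqnorm -esumZ ?abs2_ge0//; last by move=> x; exact: abs2_ge0.
  by apply: eq_esum => x _; rewrite -[in LHS]/(abs2 _) abs2M.
rewrite fineM//; rewrite /sqnorm.
by apply: (esum_fin (p := fun x => abs2 (f x))); [move=> x; exact: abs2_ge0|rewrite -ell2E].
Qed.

Lemma l2normZr (t : R) f : ell2 f -> l2norm ((t%:C)%C *: f) = `|t| * l2norm f.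
Proof. by move=> sf; rewrite l2normZ// abs2_real sqrtr_sqr. Qed.

Lemma l2normN f : ell2 f -> l2norm (- f) = l2norm f.
Proof. by move=> sf; rewrite -scaleN1C l2normZr// normrN1 mul1r. Qed.

Lemma l2norm_sum (I : Type) (s : seq I) (F : I -> T -> C) :
  (forall i, ell2 (F i)) ->
  l2norm (\sum_(i <- s) F i) <= \sum_(i <- s) l2norm (F i).
Proof.
move=> sF; elim: s => [|i s IH]; first by rewrite !big_nil l2norm0.
rewrite !big_cons (le_trans (l2normD _ _))//; first exact: ell2_sum.
by rewrite lerD2l.
Qed.

(** Hence [matrix_element A x y] is the value of [A (delta y)] at [x], the form used when [A] is
    transported to the graphs. *)
Lemma dot_delta x f : dot (delta R x) f = f x.
Proof.
rewrite /dot /csum; pose u y := conjc (delta R x y) * f y; rewrite -/u.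
have u0 y : y != x -> u y = 0.
  by move=> yx; rewrite /u /delta (negbTE yx) conjc0 mul0r.
have ux : u x = f x by rewrite /u /delta eqxx conjc1 mul1r.
rewrite (@rsum_single _ _ x (fun y => Re (u y))); last by move=> y /u0 ->.
rewrite (@rsum_single _ _ x (fun y => Im (u y))); last by move=> y /u0 ->.
by rewrite ux; case: (f x).
Qed.

Lemma abs2_delta (x y : T) : abs2 (delta R x y) = (y == x)%:R.
Proof. by rewrite /delta; case: eqP => _; rewrite /abs2 /= ?expr1n ?expr0n /= ?addr0. Qed.

Lemma sqnorm_delta x : @sqnorm R T (delta R x) = 1%E.
Proof.
rewrite /sqnorm (esumID [set x]); last by move=> y _; rewrite lee_fin abs2_ge0.
rewrite setTI esum_set1; last by rewrite lee_fin abs2_ge0.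
rewrite -/(abs2 _) abs2_delta eqxx esum1 ?adde0// => y [_ /= /eqP yx].
by rewrite -/(abs2 _) abs2_delta (negbTE yx).
Qed.

Lemma ell2_delta x : @ell2 R T (delta R x).
Proof. by rewrite /ell2 /= sqnorm_delta ltry. Qed.

Lemma l2norm_delta x : @l2norm R T (delta R x) = 1.
Proof. by rewrite /l2norm sqnorm_delta sqrtr1. Qed.

Lemma sum_le_l2norm (s : seq T) f : uniq s -> ell2 f ->
  \sum_(x <- s) abs2 (f x) <= l2norm f ^+ 2.
Proof.
move=> us sf; rewrite l2norm2 ipE -lee_fin fineK; last first.
  by apply: (esum_fin (p := fun x => abs2 (f x))); [move=> x; exact: abs2_ge0|rewrite -ell2E].
apply: esum_ge; exists [set` s]; first by split.
by rewrite -fsbig_seq// -sumEFin.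
Qed.

(** [sqnorm f] is a finite supremum of finite sums, so some [F] carries all of it but [e]; a finite
    set disjoint from [F] has only that remainder left. *)
Lemma ell2_tail f (e : R) : ell2 f -> 0 < e -> exists F : seq T,
  forall s, uniq s -> (forall x, x \in s -> x \notin F) ->
    \sum_(x <- s) abs2 (f x) <= e.
Proof.
move=> sf e0.
have fin : sqnorm f \is a fin_num.
  by apply: (esum_fin (p := fun x => abs2 (f x))); [move=> x; exact: abs2_ge0|rewrite -ell2E].
have [_ [X [finX _] <-]] : exists2 y, [set (\sum_(x \in A) (abs2 (f x))%:E)%E | A in fsets [set: T]] y
    & (sqnorm f - e%:E < y)%E.
  by apply: ub_ereal_sup_adherent.
move=> lt; exists (fset_set X) => s us sX.
have := @sum_le_l2norm (s ++ fset_set X) f.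
rewrite cat_uniq us fset_uniq andbT /=.
have -> : ~~ has (in_mem^~ (mem s)) (fset_set X).
  by apply/hasPn => x xX; apply/negP => /sX; rewrite xX.
move=> /(_ isT sf); rewrite big_cat /= l2norm2 ipE.
move: lt; rewrite fsbig_finite//= sumEFin -(fineK fin) -EFinB lte_fin.
by lra.
Qed.

End Ell2.

(** * Spectral pieces of a self-adjoint operator *)

Section SecondMoment.
Variable R : realType.
Implicit Types (m : {measure set (measurableTypeR R) -> \bar R})
  (B C : set (measurableTypeR R)).

Lemma integrable_cst_fin m B (k : R) : measurable B -> (m setT < +oo)%E ->
  m.-integrable B (EFin \o cst k).
Proof.
move=> mB mT; apply/integrableP; split; first exact/measurable_EFinP.
rewrite /= integral_cst//; apply: lte_mul_pinfty => //.
by apply: le_lt_trans mT; apply: le_measure; rewrite ?inE.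
Qed.

(** |t| is dominated by t^2 + 1. *)
Lemma integrable_id m : (m setT < +oo)%E ->
  (\int[m]_t ((t : R) ^+ 2)%:E < +oo)%E ->
  m.-integrable setT (EFin \o (fun t : measurableTypeR R => (t : R))).
Proof.
move=> mT m2.
have mid : measurable_fun setT (fun t : measurableTypeR R => (t : R)).
  exact: measurable_id.
apply: (@le_integrable _ _ _ m _ measurableT _
  (EFin \o (fun t : measurableTypeR R => (t : R) ^+ 2 + 1))).
- exact/measurable_EFinP.
- move=> x _ /=; rewrite lee_fin [leRHS]ger0_norm ?addr_ge0 ?sqr_ge0//.
  have := sqr_ge0 (x - 1 : R); have := sqr_ge0 (x + 1 : R).
  have := sqr_ge0 (x : R).
  by rewrite !expr2 => ? ? ?; rewrite ler_norml; apply/andP; split; lra.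
pose sqr := fun t : measurableTypeR R => (t : R) ^+ 2.
rewrite (_ : _ \o _ = ((EFin \o sqr) \+ (EFin \o cst 1%R))%E); last by [].
apply: integrableD => //; last exact: integrable_cst_fin.
apply/integrableP; split.
  by apply/measurable_EFinP; exact: measurable_funX.
by under eq_integral do rewrite /= ger0_norm ?sqr_ge0//.
Qed.

Lemma integral_sub_bound m B (t w : R) : measurable B ->
  (forall x, B x -> `|x - t| <= w) -> (m setT < +oo)%E ->
  (\int[m]_x ((x : R) ^+ 2)%:E < +oo)%E ->
  `| (\int[m]_(x in B) (x : R)) - t * fine (m B) | <= w * fine (m B).
Proof.
move=> mB Bw mT m2; have iid := integrableS measurableT mB (@subsetT _ B) (integrable_id mT m2).
have ic k := integrable_cst_fin k mB mT.
have lo : (t - w) * fine (m B) <= \int[m]_(x in B) (x : R).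
  rewrite -(Rintegral_cst m mB); apply: le_Rintegral => //; first exact: ic.
  by move=> x /Bw; rewrite ler_norml => /andP[]; lra.
have hi : \int[m]_(x in B) (x : R) <= (t + w) * fine (m B).
  rewrite -(Rintegral_cst m mB); apply: le_Rintegral => //; first exact: ic.
  by move=> x /Bw; rewrite ler_norml => /andP[]; lra.
by rewrite ler_norml; apply/andP; split; lra.
Qed.

(** Split both integrals over [B] and its complement. The complement contributes equally to both and
    cancels; on [B] the integrand x - t is at most [w] in absolute value. *)
Lemma integral_id_diff m1 m2 B (t w a1 a2 : R) : measurable B ->
  0 <= w -> (forall x, B x -> `|x - t| <= w) -> m1 setT = a1%:E -> m2 setT = a2%:E ->
  (\int[m1]_x ((x : R) ^+ 2)%:E < +oo)%E ->
  (\int[m2]_x ((x : R) ^+ 2)%:E < +oo)%E ->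
  (forall C, measurable C -> C `<=` ~` B -> m1 C = m2 C) ->
  ((\int[m1]_x (x : R)) - t * a1) - ((\int[m2]_x (x : R)) - t * a2)
    <= w * (a1 + a2).
Proof.
move=> mB w0 Bw m1T m2T i1 i2 m12.
have f1 : (m1 setT < +oo)%E by rewrite m1T ltry.
have f2 : (m2 setT < +oo)%E by rewrite m2T ltry.
have mBc := measurableC mB.
have split_int m : (m setT < +oo)%E -> (\int[m]_x ((x : R) ^+ 2)%:E < +oo)%E ->
    \int[m]_x (x : R) = \int[m]_(x in B) (x : R) + \int[m]_(x in ~` B) (x : R).
  move=> fm im; rewrite -Rintegral_setU//; first by rewrite setUv.
  - by rewrite setUv; exact: integrable_id.
  - by apply/disj_setPS => x [].
have split_m m a : m setT = a%:E ->
    [/\ a = fine (m B) + fine (m (~` B)), 0 <= fine (m B) & 0 <= fine (m (~` B))].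
  move=> mT; split; [|exact: fine_ge0..].
  have fin C : measurable C -> m C \is a fin_num.
    move=> mC; rewrite ge0_fin_numE//; apply: le_lt_trans (ltry a).
    by rewrite -mT; apply: le_measure; rewrite ?inE.
  have mU : (m setT = m B + m (~` B))%E by rewrite -measureU ?setICr// setUv.
  by rewrite -fineD ?fin// -mU mT.
have := integral_sub_bound mB Bw f1 i1.
have := integral_sub_bound mB Bw f2 i2.
rewrite (split_int m1)// (split_int m2)//.
have [-> b1 c1] := split_m _ _ m1T; have [-> b2 c2] := split_m _ _ m2T.
have -> : \int[m1]_(x in ~` B) (x : R) = \int[m2]_(x in ~` B) (x : R).
  by rewrite /Rintegral (eq_measure_integral m2).
have e12 : m1 (~` B) = m2 (~` B) by apply: m12.
rewrite -e12 in c2 *.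
rewrite !ler_norml => /andP[h1 h2] /andP[h3 h4].
(* The right-hand side contains the total masses, so a multiple of this nonnegative term is to
   spare. *)
have h5 : 0 <= w * fine (m1 (~` B)) by exact: mulr_ge0.
lra.
Qed.

(** The measure lives on [B], where |x| <= |t| + w. *)
Lemma second_moment_bounded m B (t w : R) : measurable B ->
  (forall x, B x -> `|x - t| <= w) -> (m setT < +oo)%E -> m (~` B) = 0%E ->
  (\int[m]_x ((x : R) ^+ 2)%:E < +oo)%E.
Proof.
move=> mB Bw mT m0.
have mf C : measurable_fun C (EFin \o (fun x : measurableTypeR R => (x : R) ^+ 2)).
  apply/measurable_EFinP; apply: measurable_funX.
  by apply: measurable_funTS; exact: measurable_id.
rewrite -(setUv B) ge0_integral_setU//; first last.
- by apply/disj_setPS => x [].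
- by move=> x _; rewrite lee_fin sqr_ge0.
- exact: measurableC.
rewrite [X in (_ + X)%E]null_set_integral ?adde0//; last exact: measurableC.
apply: (@le_lt_trans _ _ (\int[m]_(x in B) cst ((`|t| + w) ^+ 2)%:E x)%E).
  apply: ge0_le_integral => //.
  - by move=> x _; rewrite lee_fin sqr_ge0.
  - move=> x /Bw xt; rewrite lee_fin -[leLHS]ger0_norm ?sqr_ge0// normrX.
    have h : `|x| <= `|t| + w.
      rewrite -(subrK t x) addrC; apply: le_trans (ler_normD _ _) _.
      by rewrite lerD2l.
    by apply: lerXn2r; rewrite ?nnegrE// (le_trans _ h).
rewrite integral_cst//; apply: lte_mul_pinfty => //; first by rewrite lee_fin sqr_ge0.
by apply: le_lt_trans mT; apply: le_measure; rewrite ?inE.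
Qed.

End SecondMoment.

(** * Linear operators on a domain *)

Section LinearOperators.
Variables (R : realType) (T : choiceType).
Variables (D : set (T -> R[i])) (L : (T -> R[i]) -> (T -> R[i])).
Hypothesis linL : linear_operator D L.

Lemma linop_ell2 f : D f -> ell2 f.
Proof. by case: linL => h _ _ _; exact: h. Qed.

Lemma linop_ell2r f : D f -> ell2 (L f).
Proof. by case: linL => _ _ h _; exact: h. Qed.

Lemma linopD f g : D f -> D g -> D (f + g) /\ L (f + g) = L f + L g.
Proof. by case: linL => _ _ _ h Df Dg; have := h 1 f g Df Dg; rewrite !scale1r. Qed.

Lemma linop0 : L 0 = 0.
Proof.
case: linL => _ D0 _ h; have [_] := h (-1) 0 0 D0 D0.
by rewrite scaler0 addr0 scaleN1r addNr.
Qed.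

Lemma linopZ (c : R[i]) f : D f -> D (c *: f) /\ L (c *: f) = c *: L f.
Proof.
by case: linL => _ D0 _ h Df; have := h c f 0 Df D0; rewrite linop0 !addr0.
Qed.

Lemma linopB f g : D f -> D g -> D (f - g) /\ L (f - g) = L f - L g.
Proof.
move=> Df Dg; have [] := linopZ (-1) Dg; rewrite !scaleN1r => DN LN.
by rewrite -LN; exact: linopD.
Qed.

Lemma linop_sum (I : Type) (s : seq I) (F : I -> T -> R[i]) :
  (forall i, D (F i)) ->
  D (\sum_(i <- s) F i) /\ L (\sum_(i <- s) F i) = \sum_(i <- s) L (F i).
Proof.
move=> DF; elim: s => [|i s [IH1 IH2]].
  by rewrite !big_nil linop0; case: linL.
by rewrite !big_cons -IH2; exact: linopD.
Qed.

End LinearOperators.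

(** * Projection-valued measures *)

Section ProjectionValuedMeasures.
Variables (R : realType) (T : choiceType).
Variable E : set (measurableTypeR R) -> (T -> R[i]) -> (T -> R[i]).
Hypothesis pvmE : projection_valued_measure E.
Implicit Types (f g : T -> R[i]) (B C : set (measurableTypeR R)).

(** A squared norm, so that positivity is immediate and Pythagoras applies; [pvm_ip] identifies it
    with the measure <f, E(B) f>. *)
Definition mass f B : R := ip (E B f) (E B f).

Lemma pvm_lin B : measurable B -> linear_operator (@ell2 R T) (E B).
Proof. by case: pvmE => h _ _ _ /h[]. Qed.

Lemma pvm_ell2 B f : measurable B -> ell2 f -> ell2 (E B f).
Proof. by move=> mB lf; exact: (linop_ell2r (pvm_lin mB) lf). Qed.

Lemma pvm_sym B f g : measurable B -> ell2 f -> ell2 g ->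
  ip (E B f) g = ip f (E B g).
Proof. by case: pvmE => h _ _ _ /h[_ _ s] lf lg; rewrite -!re_dot s. Qed.

Lemma pvmI B C f : measurable B -> measurable C -> ell2 f ->
  E B (E C f) = E (B `&` C) f.
Proof. by case: pvmE => _ _ h _ mB mC lf; rewrite h. Qed.

Lemma pvmT f : ell2 f -> E setT f = f.
Proof. by case: pvmE => _ h _ _; exact: h. Qed.

Lemma pvm_ip B f : measurable B -> ell2 f -> ip f (E B f) = mass f B.
Proof.
move=> mB lf; have lE := pvm_ell2 mB lf.
by rewrite /mass pvm_sym// pvmI// setIid.
Qed.

Lemma pvm_measure f : ell2 f ->
  exists mu : {measure set (measurableTypeR R) -> \bar R},
    scalar_spectral_measure E f mu /\
    forall B, measurable B -> mu B = (mass f B)%:E.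
Proof.
case: pvmE => _ _ _ h lf; have [mu hmu] := h f lf.
by exists mu; split => // B mB; rewrite hmu// re_dot pvm_ip.
Qed.

Lemma massT f : ell2 f -> mass f setT = ip f f.
Proof. by move=> lf; rewrite /mass pvmT. Qed.

Lemma mass_ge0 f B : 0 <= mass f B.
Proof. exact: ip_ge0. Qed.

Lemma massU f B C : ell2 f -> measurable B -> measurable C ->
  B `&` C = set0 -> mass f (B `|` C) = mass f B + mass f C.
Proof.
move=> /pvm_measure[mu [_ muE]] mB mC BC; apply: EFin_inj.
by rewrite EFinD -!muE//; [exact: measureU|exact: measurableU].
Qed.

Lemma le_mass f B C : ell2 f -> measurable B -> measurable C ->
  B `<=` C -> mass f B <= mass f C.
Proof.
move=> /pvm_measure[mu [_ muE]] mB mC BC; rewrite -lee_fin -!muE//.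
by apply: le_measure; rewrite ?inE.
Qed.

Lemma l2norm_eq0 f : ell2 f -> ip f f = 0 -> f = 0.
Proof.
move=> lf f0; apply/funext => x.
have := @sum_le_l2norm _ _ [:: x] f isT lf; rewrite l2norm2 f0 big_seq1 /abs2.
case: (f x) => a b /= h; have := sqr_ge0 a; have := sqr_ge0 b => b0 a0.
have /eqP : a ^+ 2 = 0 by lra.
have /eqP : b ^+ 2 = 0 by lra.
by rewrite !sqrf_eq0 => /eqP -> /eqP ->.
Qed.

Lemma pvm0 f : ell2 f -> E set0 f = 0.
Proof.
move=> lf; apply: l2norm_eq0; first exact: pvm_ell2.
have [mu [_ muE]] := pvm_measure lf.
by apply: EFin_inj; rewrite -/(mass f set0) -muE// measure0.
Qed.

Lemma pvm_disjoint B C f : measurable B -> measurable C -> ell2 f ->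
  B `&` C = set0 -> E B (E C f) = 0.
Proof. by move=> mB mC lf BC; rewrite pvmI// BC pvm0. Qed.

(* Removing the components E (B k) f one at a time, Pythagoras applies at each
   step. *)
Lemma sub_pieces (B : nat -> set (measurableTypeR R)) f m : ell2 f ->
  (forall k, measurable (B k)) ->
  (forall j k, j <> k -> B j `&` B k = set0) ->
  ip (f - \sum_(k < m) E (B k) f) (f - \sum_(k < m) E (B k) f)
    = ip f f - \sum_(k < m) mass f (B k).
Proof.
move=> lf mB dB; elim: m => [|m IH]; first by rewrite !big_ord0 !subr0.
have lEk k : ell2 (E (B k) f) by exact: pvm_ell2.
have lS : ell2 (\sum_(k < m) E (B k) f) by exact: ell2_sum.
rewrite !big_ord_recr /= !opprD !addrA ip_B//; last exact: ell2B.
rewrite IH -/(mass f (B m)).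
suff -> : ip (f - \sum_(k < m) E (B k) f) (E (B m) f) = mass f (B m) by lra.
rewrite -pvm_sym//; last exact: ell2B.
have [_ ->] := linopB (pvm_lin (mB m)) lf lS.
have [_ ->] := linop_sum (pvm_lin (mB m)) (index_enum _) (fun k : 'I_m => lEk k).
rewrite big1 ?subr0; first by rewrite -pvm_ip// ipC.
by move=> k _; apply: pvm_disjoint => //; apply: dB; apply/eqP; rewrite gtn_eqF.
Qed.

End ProjectionValuedMeasures.

(** * The operator on bounded spectral pieces *)

Section SpectralMeasures.
Variables (R : realType) (T : choiceType).
Variables (D : set (T -> R[i])) (A : (T -> R[i]) -> (T -> R[i])).
Variable E : set (measurableTypeR R) -> (T -> R[i]) -> (T -> R[i]).
Hypothesis saA : self_adjoint D A.
Hypothesis specE : spectral_measure D A E.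
Implicit Types (f g : T -> R[i]) (B C : set (measurableTypeR R)).

Let pvmE : projection_valued_measure E. Proof. by case: specE. Qed.
Let linA : linear_operator D A. Proof. by case: saA. Qed.

Lemma sa_sym f g : D f -> D g -> ip (A f) g = ip f (A g).
Proof.
move=> Df Dg; case: saA => _ _ h; rewrite -!re_dot; congr complex.Re.
by apply: (proj2 (h g (A g) (linop_ell2 linA Dg) (linop_ell2r linA Dg))).
Qed.

(** The spectral measure of [f] has no mass off the bounded set [B], so its second moment is finite,
    which is the criterion for membership in [D]. *)
Lemma spectral_piece_dom B t w f : measurable B ->
  (forall x, B x -> `|x - t| <= w) -> ell2 f -> E B f = f -> D f.
Proof.
move=> mB Bw lf Bf; have [mu [smu muE]] := pvm_measure pvmE lf.
case: specE => _ /(_ f mu lf smu)[h _]; apply/h.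
apply: (second_moment_bounded mB Bw); first by rewrite muE// ltry.
rewrite muE; last exact: measurableC.
have mBc := measurableC mB.
by rewrite /mass -{1 2}Bf pvm_disjoint// ?setICl// -l2norm2 l2norm0 expr0n.
Qed.

(* On f +- g, the measures agree off B, since E C f = 0 there. *)
Lemma spectral_piece_form B t w f g : 0 <= w -> measurable B ->
  (forall x, B x -> `|x - t| <= w) -> ell2 f -> E B f = f -> D g ->
  ip g (A f - (t%:C)%C *: f) <= w / 2 * (ip f f + ip g g).
Proof.
move=> w0 mB Bw lf Bf Dg; have Df := spectral_piece_dom mB Bw lf Bf.
have lg := linop_ell2 linA Dg.
have lAf := linop_ell2r linA Df; have lAg := linop_ell2r linA Dg.
have [Dp Ap] := linopD linA Df Dg; have [Dm Am] := linopB linA Df Dg.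
have lp := ell2D lf lg; have lm := ell2B lf lg.
have [mp [smp mpE]] := pvm_measure pvmE lp.
have [mm [smm mmE]] := pvm_measure pvmE lm.
case: specE => _ h; have [h1 h2] := h _ _ lp smp; have [h3 h4] := h _ _ lm smm.
have mpm C : measurable C -> C `<=` ~` B -> mp C = mm C.
  move=> mC CB; rewrite mpE// mmE//; congr EFin.
  have Cf : E C f = 0.
    by rewrite -Bf pvm_disjoint//; rewrite -subset0 => x [/CB].
  have linC := pvm_lin pvmE mC; have lCg := pvm_ell2 pvmE mC lg.
  rewrite /mass (linopD linC lf lg).2 (linopB linC lf lg).2 Cf add0r sub0r.
  by rewrite ipNl ?(ipC _ (- _)) ?ipNl ?opprK//; exact: ell2N.
have mpT : mp setT = (ip (f + g) (f + g))%:E by rewrite mpE// massT.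
have mmT : mm setT = (ip (f - g) (f - g))%:E by rewrite mmE// massT.
have := integral_id_diff mB w0 Bw mpT mmT (h1.1 Dp) (h3.1 Dm) mpm.
have := congr1 (@complex.Re R) (h2 Dp); rewrite re_dot /= => <-.
have := congr1 (@complex.Re R) (h4 Dm); rewrite re_dot /= => <-.
(* Polarisation: by symmetry of [A], the forms at f + g and f - g differ by 4 <g, A f> in real
   part. *)
have Ep : ip (f + g) (A f + A g) = ip f (A f) + 2 * ip g (A f) + ip g (A g).
  rewrite (ipDl lf lg (ell2D lAf lAg)) (ipDr lf lAf lAg) (ipDr lg lAf lAg).
  by rewrite -(sa_sym Df Dg) (ipC (A f) g); ring.
have Em : ip (f - g) (A f - A g) = ip f (A f) - 2 * ip g (A f) + ip g (A g).
  rewrite (ipBl lf lg (ell2B lAf lAg)) (ipBr lf lAf lAg) (ipBr lg lAf lAg).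
  by rewrite -(sa_sym Df Dg) (ipC (A f) g); ring.
rewrite Ap Am Ep Em (ip_D lf lg) (ip_B lf lg).
rewrite (ipBr lg lAf (ell2Z _ lf)) (ipZr _ lg lf) (ipC g f).
by lra.
Qed.

(** Let u = (A - t) f. At g = u / w, [spectral_piece_form] would read |u|^2 / w <= w/2 (|f|^2 +
    |u|^2 / w^2), where the term in |u|^2 on the right absorbs half of the left side. *)
Lemma spectral_piece_norm B t w f : 0 < w -> measurable B ->
  (forall x, B x -> `|x - t| <= w) -> ell2 f -> E B f = f ->
  l2norm (A f - (t%:C)%C *: f) <= w * l2norm f.
Proof.
move=> w0 mB Bw lf Bf; have Df := spectral_piece_dom mB Bw lf Bf.
set u := A f - _.
have lu : ell2 u by apply: ell2B; [exact: linop_ell2r linA _ Df|exact: ell2Z].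
pose v := ((w^-1)%:C)%C *: u.
have lv : ell2 v by exact: ell2Z.
(* The vector [v] may lie outside [D], so the form bound is tested on some [g] in [D] within [e] of
   it. *)
have key (e : R) : 0 < e ->
    ip v u <= w / 2 * (ip f f + (l2norm v + e) ^+ 2) + e * l2norm u.
  move=> e0; case: saA => _ /(_ v e lv e0)[g Dg vg] _.
  have lg := linop_ell2 linA Dg; have lvg := ell2B lv lg.
  have -> : ip v u = ip g u + ip (v - g) u by rewrite ipBl//; lra.
  apply: lerD; last first.
    apply: le_trans (ip_CS lvg lu) _.
    by apply: ler_wpM2r; [exact: l2norm_ge0|exact: ltW].
  apply: le_trans (spectral_piece_form (ltW w0) mB Bw lf Bf Dg) _.
  rewrite ler_pM2l ?divr_gt0// lerD2l -l2norm2.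
  apply: lerXn2r; rewrite ?nnegrE ?l2norm_ge0//.
    by rewrite addr_ge0 ?l2norm_ge0// ltW.
  have -> : g = v - (v - g) by rewrite opprB addrC subrK.
  apply: le_trans (l2normD lv (ell2N lvg)) _.
  by rewrite l2normN// lerD2l ltW.
have lim : ip v u <= w / 2 * (ip f f + ip v v).
  apply/ler_addgt0Pr => e e0.
  (* Since [d <= 1] gives d^2 <= d, the total error in [key d] is at most [d * K]. *)
  pose K := w / 2 * (2 * l2norm v + 1) + l2norm u + 1.
  have K0 : 0 < K.
    have := l2norm_ge0 u; have := l2norm_ge0 v => v0 u0.
    by rewrite ltr_wpDl// addr_ge0// mulr_ge0 ?divr_ge0 ?addr_ge0 ?mulr_ge0// ltW.
  pose d := Num.min 1 (e / K).
  have d0 : 0 < d by rewrite lt_min ltr01 divr_gt0.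
  have d1 : d <= 1 by rewrite ge_min lexx.
  have dK : d * K <= e by rewrite -ler_pdivlMr// ge_min lexx orbT.
  apply: le_trans (key d d0) _.
  rewrite -(l2norm2 v); have dd : d * d <= d by rewrite ler_piMr// ltW.
  have := ler_wpM2l (ltW (divr_gt0 w0 (ltr0Sn R 1))) dd.
  by move: dK d0; rewrite /K; clearbody d; rewrite !expr2; lra.
have vu : ip v u = w^-1 * ip u u by rewrite ipZl.
have vv : ip v v = w^-1 ^+ 2 * ip u u by rewrite ipZl// ipZr//; ring.
have fin : ip u u <= w ^+ 2 * ip f f.
  move: lim; rewrite vu vv => lim.
  have -> : ip u u = 2 * w * (w^-1 * ip u u) - w ^+ 2 * (w^-1 ^+ 2 * ip u u).
    by field; rewrite gt_eqF.
  have w2 : 0 <= 2 * w by rewrite mulr_ge0// ltW.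
  by have := ler_wpM2l w2 lim; rewrite !expr2; lra.
rewrite !l2normE -(ger0_norm (ltW w0)) -sqrtr_sqr -sqrtrM ?sqr_ge0//.
exact: ler_wsqrtr.
Qed.

End SpectralMeasures.

Lemma sqrtD_le (R : realType) (a b : R) : 0 <= a -> 0 <= b ->
  Num.sqrt (a + b) <= Num.sqrt a + Num.sqrt b.
Proof.
move=> a0 b0.
rewrite -(@ler_pXn2r _ 2) ?nnegrE ?addr_ge0 ?sqrtr_ge0//.
by rewrite sqrrD !sqr_sqrtr ?addr_ge0// addrAC lerDl mulrn_wge0//.
Qed.

(** * Exhaustion of spectral mass and approximation from a core *)

Section MassExhaustion.
Variables (R : realType) (T : choiceType).
Variable E : set (measurableTypeR R) -> (T -> R[i]) -> (T -> R[i]).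
Hypothesis pvmE : projection_valued_measure E.
Implicit Types (f : T -> R[i]) (B : set (measurableTypeR R)).

(** Continuity from below of the measure B -> <f, E(B) f>. *)
Lemma mass_bigcup f (F : nat -> set (measurableTypeR R)) (e : R) : ell2 f ->
  (forall n, measurable (F n)) -> (forall n x, F n x -> F n.+1 x) -> 0 < e ->
  exists n, mass E f (\bigcup_n F n) - e < mass E f (F n).
Proof.
move=> /(pvm_measure pvmE)[mu [_ muE]] mF incF e0.
have mU : measurable (\bigcup_n F n) by exact: bigcupT_measurable.
have ndF : nondecreasing_seq F.
  by apply/nondecreasing_seqP => n; apply/subsetPset => x; exact: incF.
have := nondecreasing_cvg_mu (mu := mu) mF mU ndF.
rewrite [X in _ --> X]muE// => /fine_cvgP[_] /cvgr_gt /= h.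
have [|N _ /(_ N (leqnn N))] := h (mass E f (\bigcup_n F n) - e).
  by rewrite ltrBlDr ltrDl.
by rewrite /= muE//; exists N.
Qed.

Lemma mass_bigsetU f (B : nat -> set (measurableTypeR R)) m : ell2 f ->
  (forall k, measurable (B k)) ->
  (forall j k, j <> k -> B j `&` B k = set0) ->
  mass E f (\bigcup_(k in `I_m) B k) = \sum_(k < m) mass E f (B k).
Proof.
move=> lf mB dB; elim: m => [|m IH].
  by rewrite big_ord0 II0 bigcup_set0 /mass pvm0// -l2norm2 l2norm0 expr0n.
rewrite big_ord_recr /= -IH -massU//; last 2 first.
- by apply: bigcup_measurable => k _; exact: mB.
- rewrite setI_bigcupl; apply: bigcup0 => k /= km; apply: dB => km'.
  by rewrite km' ltnn in km.
congr mass; rewrite IIS bigcup_setU bigcup_set1//.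
Qed.

End MassExhaustion.

Section CoreApproximation.
Variables (R : realType) (T : choiceType).
Variables (D : set (T -> R[i])) (A : (T -> R[i]) -> (T -> R[i])).
Variable E : set (measurableTypeR R) -> (T -> R[i]) -> (T -> R[i]).
Hypothesis saA : self_adjoint D A.
Hypothesis specE : spectral_measure D A E.
Variable D1 : set (T -> R[i]).
Hypothesis coreA : is_core D A D1.
Implicit Types (f g : T -> R[i]) (B : set (measurableTypeR R)).

Let pvmE : projection_valued_measure E. Proof. by case: specE. Qed.
Let linA : linear_operator D A. Proof. by case: saA. Qed.

(** Each E(B_k) f lies in [D] and is replaced by a nearby [h k] in the graph norm. The first bound
    is then Pythagoras for the pieces, the second is [spectral_piece_norm] on each piece. *)
Lemma core_pieces (B : nat -> set (measurableTypeR R)) (t : nat -> R) w f m e :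
  0 < w -> 0 < e -> ell2 f ->
  (forall k, measurable (B k)) ->
  (forall j k, j <> k -> B j `&` B k = set0) ->
  (forall k x, B k x -> `|x - t k| <= w) ->
  exists h : nat -> T -> R[i], [/\ forall k, D1 (h k),
    l2norm (f - \sum_(k < m) h k)
      <= Num.sqrt (ip f f - \sum_(k < m) mass E f (B k)) + e
  & \sum_(k < m) l2norm (A (h k) - (t k)%:C%C *: h k)
      <= w * \sum_(k < m) Num.sqrt (mass E f (B k)) + e].
Proof.
move=> w0 e0 lf mB dB Bt.
(* Replacing a piece changes its residual by at most [(1 + |t k|) * d k]; this choice makes [m] such
   errors sum to at most [e], and [m.+1] keeps the divisor positive for [m = 0]. *)
pose d k := e / (m.+1%:R * (1 + `|t k|)).
have d0 k : 0 < d k by rewrite divr_gt0// mulr_gt0// ltr_wpDr.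
have Ef k : E (B k) (E (B k) f) = E (B k) f by rewrite pvmI// setIid.
have lEf k : ell2 (E (B k) f) by exact: pvm_ell2.
have DEf k : D (E (B k) f).
  exact: (spectral_piece_dom specE (mB k) (Bt k) (lEf k) (Ef k)).
case: coreA => D1D approx.
have [h hP] := choice (fun k => approx _ _ (DEf k) (d0 k)).
have Dh k : D (h k) by apply: D1D; case: (hP k).
have lh k := linop_ell2 linA (Dh k).
have lAh k := linop_ell2r linA (Dh k).
have lAE k := linop_ell2r linA (DEf k).
have dm k : (1 + `|t k|) * d k <= e / m.+1%:R.
  have t1 : 1 + `|t k| != 0 by rewrite gt_eqF// ltr_wpDr.
  by rewrite mulrC /d invfM mulrA mulfVK.
have dm1 k : d k <= e / m.+1%:R.
  by apply: le_trans (dm k); rewrite ler_peMl ?lerDl// ltW.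
have sum_e (u : nat -> R) : (forall k, u k <= e / m.+1%:R) -> \sum_(k < m) u k <= e.
  move=> ue; apply: le_trans (ler_sum _ (fun (k : 'I_m) _ => ue k)) _.
  rewrite sumr_const card_ord -[leLHS]mulr_natr mulrAC ler_pdivrMr//.
  by rewrite ler_pM2l// ler_nat.
exists h; split; first by move=> k; case: (hP k).
- have -> : f - \sum_(k < m) h k = (f - \sum_(k < m) E (B k) f)
      + \sum_(k < m) (E (B k) f - h k).
    by rewrite sumrB addrA subrK.
  have lS1 : ell2 (f - \sum_(k < m) E (B k) f).
    by apply: ell2B => //; exact: ell2_sum.
  have lS2 : ell2 (\sum_(k < m) (E (B k) f - h k)).
    by apply: ell2_sum => k; exact: ell2B.
  apply: le_trans (l2normD lS1 lS2) _; apply: lerD.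
    by rewrite l2normE (sub_pieces pvmE m lf mB dB).
  apply: le_trans (l2norm_sum _ _) _; first by move=> k; exact: ell2B.
  apply: sum_e (fun k => l2norm (E (B k) f - h k)) _ => k.
  by apply: le_trans (dm1 k); apply: ltW; case: (hP k).
- rewrite mulr_sumr -lerBlDl -sumrB.
  apply: sum_e (fun k => l2norm (A (h k) - (t k)%:C%C *: h k)
    - w * Num.sqrt (mass E f (B k))) _ => k.
  rewrite lerBlDl; apply: le_trans (lerD (lexx _) (dm k)).
  have -> : A (h k) - (t k)%:C%C *: h k
      = (A (E (B k) f) - (t k)%:C%C *: E (B k) f)
      + ((t k)%:C%C *: (E (B k) f - h k) - (A (E (B k) f) - A (h k))).
    rewrite scalerBr; apply/funext => x.
    by rewrite /GRing.add /GRing.opp /=; ring.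
  have l1 : ell2 (E (B k) f - h k) by exact: ell2B.
  have l2 : ell2 (A (E (B k) f) - A (h k)) by exact: ell2B.
  apply: le_trans (l2normD _ _) _.
  + by apply: ell2B => //; exact: ell2Z.
  + by apply: ell2B => //; exact: ell2Z.
  apply: lerD.
    have := spectral_piece_norm saA specE w0 (mB k) (Bt k) (lEf k) (Ef k).
    by rewrite [X in _ <= w * X -> _]l2normE.
  apply: le_trans (l2normD (ell2Z _ l1) (ell2N l2)) _.
  rewrite l2normN// l2normZr// mulrDl mul1r addrC.
  case: (hP k) => _ h1 h2; apply: lerD; first exact: ltW.
  by apply: ler_wpM2l => //; exact: ltW.
Qed.

(* Cut B, which lies on the side s of a, into the shells where |x - a| is in
   [k w, (k + 1) w[ with w = 1 / q.  The sum of w * sqrt (mass) over n * q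
   shells tends to 0 with w, by AM-GM and orthogonality. *)
Lemma halfline_pieces B (s a : R) f e : measurable B -> ell2 f -> 0 < e ->
  (forall x, B x -> x - a = s * `|x - a|) -> `|s| <= 1 ->
  exists (m : nat) (c : nat -> R) (h : nat -> T -> R[i]),
  [/\ forall k, 0 <= c k,
      forall k, D1 (h k),
      l2norm (f - \sum_(k < m) h k)
        <= Num.sqrt (ip f f - mass E f B) + e
    & \sum_(k < m) l2norm (A (h k) - (a + s * c k)%:C%C *: h k) <= e].
Proof.
move=> mB lf e0 Bs s1.
pose near (n : R) : set (measurableTypeR R) := [set x | `|x - a| < n].
have mdist : measurable_fun setT (fun x : measurableTypeR R => `|(x : R) - a|).
  by apply: measurableT_comp => //; apply: measurable_funB => //.
have mnear n : measurable (near n).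
  have := mdist measurableT _ (measurable_itv `]-oo, n[).
  by rewrite setTI; congr measurable; apply/seteqP; split => x; rewrite /= in_itv.
(* Truncation at distance [n] loses less than (e / 2)^2 of mass, hence at most e / 2 after the
   square root. *)
have [n hn] : exists n : nat, mass E f B - (e / 2) ^+ 2 < mass E f (B `&` near n%:R).
  have [|n x [Bx xn]||n] := @mass_bigcup _ _ _ pvmE f (fun n => B `&` near n%:R) ((e / 2) ^+ 2) lf.
  - by move=> n; exact: measurableI.
  - by split => //; apply: lt_le_trans xn _; rewrite ler_nat.
  - by rewrite exprn_gt0// divr_gt0.
  rewrite -setI_bigcupr (_ : \bigcup_n near n%:R = setT) ?setIT; first by exists n.
  apply/seteqP; split => // x _; exists (Num.bound (`|x - a| : R)) => //.
  exact: archi_boundP.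
(* The weight in the AM-GM step: the total mass is at most |f|^2, so the terms [d * mass] sum to at
   most e / 8. *)
have [d d0 hd] : exists2 d : R, 0 < d & d * (ip f f + 1) = e / 8.
  have f1 : 0 < ip f f + 1 by rewrite ltr_wpDl// ip_ge0.
  exists (e / 8 / (ip f f + 1)); first by rewrite !divr_gt0.
  by rewrite divfK// gt_eqF.
(* The number of shells per unit length; the other AM-GM terms sum to n / (4 d q). *)
have [q q0 hq] : exists2 q : nat, (0 : R) < q%:R & n%:R / (4 * d * q%:R) <= e / 8.
  exists (Num.bound (2 * n%:R / (d * e))).+1; first by rewrite ltr0n.
  have : 2 * n%:R / (d * e) <= (Num.bound (2 * n%:R / (d * e))).+1%:R.
    apply: ltW; apply: lt_le_trans (archi_boundP _) _; last by rewrite ler_nat.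
    by apply: divr_ge0; apply: mulr_ge0 => //; exact: ltW.
  move: _.+1%:R (ltr0Sn R (Num.bound (2 * n%:R / (d * e)))) => q q0.
  by rewrite ler_pdivrMr ?mulr_gt0// ler_pdivrMr ?mulr_gt0//; lra.
pose w : R := q%:R^-1.
have w0 : 0 < w by rewrite invr_gt0.
pose m := (n * q)%N.
pose c k : R := k%:R * w.
pose P k : set (measurableTypeR R) :=
  B `&` [set x | k%:R * w <= `|x - a| < k.+1%:R * w].
have mP k : measurable (P k).
  apply: measurableI => //.
  have := mdist measurableT _ (measurable_itv `[k%:R * w, k.+1%:R * w[).
  by rewrite setTI; congr measurable; apply/seteqP; split => x; rewrite /= in_itv.
have dP j k : j <> k -> P j `&` P k = set0.
  move=> /eqP jk; rewrite -subset0 => x [[_ /= /andP[j1 j2]] [_ /= /andP[k1 k2]]].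
  have := le_lt_trans j1 k2; have := le_lt_trans k1 j2.
  rewrite !ltr_pM2r// !ltr_nat !ltnS => kj jk'.
  by move: jk; rewrite eqn_leq kj jk'.
have Pt k x : P k x -> `|x - (a + s * c k)| <= w.
  move=> [Bx /= /andP[k1 k2]].
  have -> : x - (a + s * c k) = s * (`|x - a| - c k).
    by rewrite mulrBr -Bs//; ring.
  rewrite normrM; apply: le_trans (ler_piMl _ s1) _ => //.
  rewrite ger0_norm ?subr_ge0// lerBlDr ltW//.
  by move: k2; rewrite -natr1 mulrDl mul1r /c; lra.
have UP : \bigcup_(k in `I_m) P k = B `&` near n%:R.
  apply/seteqP; split => x.
    move=> [k /= km [Bx /= /andP[_ k2]]]; split => //=.
    apply: lt_le_trans k2 _; rewrite ler_pdivrMr//.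
    by rewrite -natrM ler_nat.
  move=> [Bx xn]; pose k := Num.truncn (`|x - a| * q%:R).
  have xq : 0 <= `|x - a| * q%:R by rewrite mulr_ge0.
  have /andP[k1 k2] := truncn_itv xq.
  exists k; last by split => //=; rewrite ler_pdivrMr// k1 ltr_pdivlMr.
  rewrite /= /k truncn_lt_nat// /m natrM ltr_pM2r//.
have [|h [hD h1 h2]] := @core_pieces P (fun k => a + s * c k) w f m (e / 4) w0 _ lf mP dP Pt.
  by rewrite divr_gt0.
exists m, c, h; split => //.
- by move=> k; rewrite mulr_ge0// ltW.
- apply: le_trans h1 _; rewrite -mass_bigsetU// UP.
  have mle : mass E f B <= ip f f.
    by rewrite -(massT pvmE lf); exact: le_mass.
  have : Num.sqrt (ip f f - mass E f (B `&` near n%:R))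
      <= Num.sqrt (ip f f - mass E f B) + e / 2.
    have -> : e / 2 = Num.sqrt ((e / 2) ^+ 2).
      by rewrite sqrtr_sqr ger0_norm// divr_ge0// ltW.
    apply: le_trans (sqrtD_le _ _); rewrite ?subr_ge0 ?sqr_ge0//.
    apply: ler_wsqrtr; lra.
  lra.
- apply: le_trans h2 _.
  (* AM-GM with weight [d] trades the square root for mass, whose sum over the disjoint shells is
     bounded independently of [q]. *)
  have amgm k : w * Num.sqrt (mass E f (P k)) <= d * mass E f (P k) + w ^+ 2 / (4 * d).
    have mk : mass E f (P k) = Num.sqrt (mass E f (P k)) ^+ 2.
      by rewrite sqr_sqrtr// mass_ge0.
    rewrite {2}mk; set u := Num.sqrt _.
    have -> : d * u ^+ 2 + w ^+ 2 / (4 * d) = w * u + (2 * d * u - w) ^+ 2 / (4 * d).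
      by field; rewrite gt_eqF.
    by rewrite lerDl divr_ge0 ?sqr_ge0// mulr_ge0// ltW.
  have : w * \sum_(k < m) Num.sqrt (mass E f (P k))
      <= d * \sum_(k < m) mass E f (P k) + m%:R * (w ^+ 2 / (4 * d)).
    rewrite !mulr_sumr; apply: le_trans (ler_sum _ (fun (k : 'I_m) _ => amgm k)) _.
    by rewrite big_split /= sumr_const card_ord (mulr_natl _ m).
  have -> : m%:R * (w ^+ 2 / (4 * d)) = n%:R / (4 * d * q%:R).
    by rewrite /m /w natrM; field; rewrite !gt_eqF.
  have : d * \sum_(k < m) mass E f (P k) <= e / 8.
    have : \sum_(k < m) mass E f (P k) <= ip f f + 1.
      rewrite -mass_bigsetU// UP -(massT pvmE lf).
      apply: ler_wpDr => //; apply: le_mass => //.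
      exact: measurableI.
    by move=> h3; apply: le_trans (ler_wpM2l (ltW d0) h3) _; rewrite hd.
  lra.
Qed.

End CoreApproximation.

(** * Local isomorphisms with the Cayley graph *)

Section Balls.
Variables (T L : Type) (g : ldigraph T L).

Lemma adjacent_sym x y : Defs.adjacent g x y = Defs.adjacent g y x.
Proof. by rewrite /Defs.adjacent orbC. Qed.

Lemma gball_center n v : gball g n v v.
Proof. by exists [::]. Qed.

Lemma gball_le m n v x : (m <= n)%N -> gball g m v x -> gball g n v x.
Proof. by move=> mn [p [pp lp sp]]; exists p; split => //; exact: leq_trans mn. Qed.

Lemma gball_trans m n v x y :
  gball g m v x -> gball g n x y -> gball g (m + n) v y.
Proof.
move=> [p [pp lp sp]] [q [pq lq sq]]; exists (p ++ q); split.
- by rewrite cat_path pp lp.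
- by rewrite last_cat lp.
- by rewrite size_cat leq_add.
Qed.

Lemma gball_sym n v x : gball g n v x -> gball g n x v.
Proof.
move=> [p [pp lp sp]]; exists (rev (belast v p)); split.
- rewrite -lp rev_path.
  by rewrite (eq_path (e' := Defs.adjacent g))// => y z; exact: adjacent_sym.
- by case: p lp {pp sp} => [/= ->//|y p _]; rewrite /= rev_cons last_rcons.
- by rewrite size_rev size_belast.
Qed.

Lemma gball_adjacent n v x y :
  gball g n v x -> Defs.adjacent g x y -> gball g n.+1 v y.
Proof.
move=> vx xy; rewrite -addn1; apply: gball_trans vx _.
by exists [:: y]; split => //=; rewrite xy.
Qed.

(** Every prefix of a path of length at most [n] from [v] ends inside the ball, so the induction
    never leaves it. *)
Lemma gball_ind (P : T -> Prop) n v : P v ->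
  (forall x y, gball g n v x -> gball g n v y -> Defs.adjacent g x y -> P x -> P y) ->
  forall x, gball g n v x -> P x.
Proof.
move=> Pv Ps x [p [pp <- sp]]; elim/last_ind: p pp sp => [//|p y IH].
rewrite rcons_path size_rcons last_rcons => /andP[pp py] sp.
apply: (Ps (last v p)) => //.
- by exists p; split => //; exact: ltnW.
- by exists (rcons p y); rewrite rcons_path pp py last_rcons size_rcons.
- by apply: IH => //; exact: ltnW.
Qed.

End Balls.

Lemma cayley_word (G : groupType) (S : {fset G}) (w : seq G) :
  all (fun s => s \in S) w ->
  gball (cayley S) (size w) 1%g (foldr (fun s y => (s * y)%g) 1%g w).
Proof.
elim: w => [|s w IH] /=; first by move=> _; exact: gball_center.
move=> /andP[sS /IH h]; apply: gball_adjacent h _.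
by rewrite /Defs.adjacent /= mulgK sS orbT.
Qed.

(** * Compatibility of the local isomorphisms and well-definedness of the matrix entries *)

Section LocalIsomorphisms.
Variables (R : realType) (G : groupType) (S : {fset G}).
Variables (r : nat) (V : finType) (g : ldigraph V G) (V0 : {set V}).
Variable psi : V -> V -> G.
Hypothesis psi_iso : forall v, v \in V0 ->
  labeled_iso g (cayley S) (gball g r v) (gball (cayley S) r 1%g) (psi v).
Hypothesis psi_root : forall v, v \in V0 -> psi v v = 1%g.

Lemma psi_inj v x y : v \in V0 -> gball g r v x -> gball g r v y ->
  psi v x = psi v y -> x = y.
Proof.
by move=> /psi_iso[[_ inj _] _ _] vx vy; apply: inj; rewrite inE.
Qed.

(** Surjectivity alone places a preimage only in the r-ball. Lifting the word generator by generator
    yields a path from [v], which bounds the distance by the word length. *)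
Lemma psi_lift v (w : seq G) : v \in V0 -> all (fun s => s \in S) w ->
  (size w <= r)%N -> exists2 y, gball g (size w) v y &
    psi v y = foldr (fun s y => (s * y)%g) 1%g w.
Proof.
move=> vV0; elim: w => [|s w IH] /=.
  by move=> _ _; exists v; [exact: gball_center|exact: psi_root].
move=> /andP[sS wS] wr; have [y vy py] := IH wS (ltnW wr).
have [[_ _ surj] edgeE _] := psi_iso vV0.
have := @cayley_word _ S (s :: w); rewrite /= sS => /(_ wS) /(gball_le wr) /surj[y' vy' py'].
have vyr : gball g r v y by exact: gball_le (ltnW wr) vy.
exists y'; last exact: py'.
apply: gball_adjacent vy _.
by rewrite /Defs.adjacent -(edgeE y' y)// py' py /= mulgK sS orbT.
Qed.

(** The label of an edge belongs to the graph, and every local isomorphism turns it into the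
    quotient of the images of the ends. *)
Lemma psi_edge v w x y : v \in V0 -> w \in V0 ->
  gball g r v x -> gball g r v y -> gball g r w x -> gball g r w y ->
  Defs.adjacent g x y -> (psi v y * (psi v x)^-1 = psi w y * (psi w x)^-1)%g.
Proof.
move=> vV0 wV0 vx vy wx wy.
have [_ _ labv] := psi_iso vV0; have [_ _ labw] := psi_iso wV0.
case/orP => e; last by have := labv y x vy vx e; have := labw y x wy wx e => /= -> ->.
apply: invg_inj; rewrite !invgF.
by have := labv x y vx vy e; have := labw x y wx wy e => /= -> ->.
Qed.

(** Quotients of images are products of edge labels along a path, hence the same in both charts once
    the whole n-ball of [w] lies in the r-ball of [v]. *)
Lemma psi_consistent n v w x y : (n + n + n <= r)%N -> v \in V0 -> w \in V0 ->
  gball g n w x -> gball g n w y -> gball g n v y ->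
  gball g r v x /\ (psi w x * (psi w y)^-1 = psi v x * (psi v y)^-1)%g.
Proof.
move=> nr vV0 wV0 wx wy vy.
(* From [v] to [y], from [y] to [w], from [w] to [u]: three radii [n]. *)
have far u : gball g n w u -> gball g r v u.
  move=> wu; apply: gball_le nr _; apply: gball_trans wu.
  by apply: gball_trans vy _; exact: gball_sym.
have nr' : (n <= r)%N by apply: leq_trans nr; rewrite -addnA leq_addr.
split; first exact: far.
(* Quotients are first compared relative to the centre [w], where paths inside its ball start;
   combining the cases of [x] and [y] removes [w]. *)
have H : forall u, gball g n w u ->
    (psi w u * (psi w w)^-1 = psi v u * (psi v w)^-1)%g.
  apply: gball_ind; first by rewrite !mulgV.
  move=> u u' wu wu' adj IH.
  have := psi_edge wV0 vV0 (gball_le nr' wu) (gball_le nr' wu') (far _ wu) (far _ wu') adj.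
  move=> e; rewrite -(divgKA (psi w u) (psi w u') ((psi w w)^-1)%g) e IH.
  by rewrite divgKA.
have := H _ wx; have := H _ wy => ey ex.
rewrite -(mulgKA (psi w w)^-1%g) ex ey.
by rewrite mulgKA.
Qed.

Section ApproxElement.
Variable a : G -> G -> R[i].
Hypothesis a_inv : forall x y z, a x y = a (x * z)%g (y * z)%g.
Local Notation ar := (approx_element a r g V0 psi).

Lemma a_div x y x' y' : (x * y^-1 = x' * y'^-1)%g -> a x y = a x' y'.
Proof. by move=> e; rewrite (a_inv x y y^-1) (a_inv x' y' y'^-1) e !mulgV. Qed.

Lemma third3 : (r %/ 3 + r %/ 3 + r %/ 3 <= r)%N.
Proof. by apply: leq_trans (leq_trunc_div r 3); rewrite !mulnS muln0 addn0 addnA. Qed.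

(** [pick] may return another vertex, but [psi_consistent] gives it the same quotient, and by
    invariance [a] depends on the quotient only. *)
Lemma approx_element_near v x y : v \in V0 -> gball g (r %/ 3) v x ->
  gball g (r %/ 3) v y -> ar x y = a (psi v x) (psi v y).
Proof.
move=> vV0 vx vy; rewrite /approx_element; case: pickP => [w|/(_ v)].
  move=> /andP[wV0 /andP[]]; rewrite !inE => wx wy.
  by apply: a_div; apply: (psi_consistent third3 vV0 wV0 wx wy vy).2.
by rewrite vV0 /= !mem_set.
Qed.

(** A vertex found by [pick] is near both [x] and [y], so [psi_consistent] still applies when [x] is
    outside the smaller ball of [v]. This controls the whole column of A_r at [y]. *)
Lemma approx_element_far v x y : v \in V0 -> gball g (r %/ 3) v y ->
  ar x y = 0 \/ gball g r v x /\ ar x y = a (psi v x) (psi v y).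
Proof.
move=> vV0 vy; rewrite /approx_element; case: pickP => [w|_]; last by left.
move=> /andP[wV0 /andP[]]; rewrite !inE => wx wy; right.
have [vx e] := psi_consistent third3 vV0 wV0 wx wy vy.
by split => //; exact: a_div.
Qed.

(** The condition searched by [pick] is symmetric in [x] and [y], so both entries use the same
    vertex. *)
Lemma approx_element_conj x y : (forall p q, conjc (a p q) = a q p) ->
  conjc (ar x y) = ar y x.
Proof.
move=> aJ; rewrite /approx_element.
rewrite (eq_pick (Q := [pred v | (v \in V0) && ((y \in gball g (r %/ 3) v) && (x \in gball g (r %/ 3) v))])).
  by case: pickP => [v _|_]; rewrite ?aJ ?conjc0.
by move=> v /=; rewrite [X in _ && X]andbC.
Qed.

End ApproxElement.
End LocalIsomorphisms.

(** * Functions on finite vertex sets, kernel operators and pullbacks *)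

Lemma l2norm_fin (R : realType) (V : finType) (f : V -> R[i]) :
  l2norm f ^+ 2 = \sum_x abs2 (f x).
Proof.
rewrite l2norm2 ipE /sqnorm -[X in esum X](_ : [set` enum V] = setT); last first.
  by apply/seteqP; split => // x _ /=; rewrite mem_enum.
by rewrite esum_fset//= => [|x _]; rewrite ?lee_fin ?abs2_ge0// -fsbig_seq ?enum_uniq//
  sumEFin big_enum.
Qed.

Lemma ell2_fin (R : realType) (V : finType) (f : V -> R[i]) : ell2 f.
Proof.
rewrite /ell2 /= /sqnorm -[X in esum X](_ : [set` enum V] = setT); last first.
  by apply/seteqP; split => // x _ /=; rewrite mem_enum.
by rewrite esum_fset//= => [|x _]; rewrite ?lee_fin ?abs2_ge0// -fsbig_seq ?enum_uniq//
  sumEFin ltry.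
Qed.

Section KernelOperators.
Variables (R : realType) (V : finType) (k : V -> V -> R[i]).

Definition kernel_op (f : V -> R[i]) : V -> R[i] := fun x => \sum_y k x y * f y.

Lemma kernel_op_is_linear : linear kernel_op.
Proof.
move=> c f h; apply/funext => x; rewrite /kernel_op.
rewrite -[RHS]/(c * _ + _) mulr_sumr -big_split /=.
by apply: eq_bigr => y _; rewrite -[(c *: f + h) y]/(c * f y + h y); ring.
Qed.

HB.instance Definition _ :=
  GRing.isLinear.Build R[i] (V -> R[i]) (V -> R[i]) _ kernel_op kernel_op_is_linear.

Lemma kernel_op_delta y x : kernel_op (delta R y) x = k x y.
Proof.
rewrite /kernel_op (bigD1 y)//= big1 ?addr0 => [|z zy].
  by rewrite /delta eqxx mulr1.
by rewrite /delta (negbTE zy) mulr0.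
Qed.

End KernelOperators.

Section Pullback.
Variables (R : realType) (T : choiceType) (V : finType) (B : set V) (p : V -> T).

(** Copies a function on the group into the graph: below, [p] is the local isomorphism at a vertex
    [v] and [B] the r-ball around [v]. *)
Definition pullback (f : T -> R[i]) : V -> R[i] :=
  fun x => if x \in B then f (p x) else 0.

Lemma pullback_is_linear : linear pullback.
Proof.
move=> c f h; apply/funext => x; rewrite /pullback -[RHS]/(c * _ + _).
by case: ifP => _ //; rewrite mulr0 addr0.
Qed.

HB.instance Definition _ :=
  GRing.isLinear.Build R[i] (T -> R[i]) (V -> R[i]) _ pullback pullback_is_linear.

Hypothesis p_inj : forall x y, B x -> B y -> p x = p y -> x = y.

Lemma pullback_delta y z : B y -> p y = z -> pullback (delta R z) = delta R y.
Proof.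
move=> By <-; apply/funext => x; rewrite /pullback /delta.
case: ifPn => [/set_mem Bx|xB].
  congr (_%:R); congr nat_of_bool; apply/eqP/eqP => [|->//]; exact: p_inj.
by case: eqP => // xy; rewrite xy mem_set in xB.
Qed.

Lemma pullback_sum (s : seq V) (f : T -> R[i]) : uniq s ->
  {in s, forall x, B x} ->
  exists s' : seq T, [/\ uniq s', s' = map p s
    & \sum_(x <- s) abs2 (pullback f x) = \sum_(y <- s') abs2 (f y)].
Proof.
move=> us sB; exists (map p s); split => //.
  by rewrite map_inj_in_uniq// => x y xs ys; apply: p_inj; exact: sB.
rewrite big_map big_seq [RHS]big_seq; apply: eq_bigr => x xs.
by rewrite /pullback mem_set//; exact: sB.
Qed.

(** By injectivity of [p] on [B], each value of [f] is copied at most once. *)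
Lemma l2norm_pullback f : ell2 f -> l2norm (pullback f) <= l2norm f.
Proof.
move=> lf; rewrite -(@ler_pXn2r _ 2) ?nnegrE ?l2norm_ge0// l2norm_fin.
have [|x|s' [us' _ e]] := @pullback_sum [seq x <- enum V | x \in B] f.
- by rewrite filter_uniq// enum_uniq.
- by rewrite mem_filter => /andP[/set_mem].
rewrite -big_enum (bigID (mem B)) /= [X in _ + X]big1 ?addr0 => [|x]; last first.
  by rewrite /pullback => /negbTE ->; rewrite abs2_0.
by rewrite -big_filter e sum_le_l2norm.
Qed.

End Pullback.

(** * Transport of the operator from the group to the graphs *)

Section Transport.
Variables (R : realType) (G : groupType) (S : {fset G}).
Variables (V : nat -> finType) (Gamma : forall r, ldigraph (V r) G).
Variables (V0 : forall r, {set V r}) (psi : forall r, V r -> V r -> G).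
Variables (D : set (G -> R[i])) (A : (G -> R[i]) -> (G -> R[i])).
Hypothesis S_gen : symmetric_generating S.
Hypothesis psi_iso : forall r v, v \in V0 r ->
  labeled_iso (Gamma r) (cayley S)
    (gball (Gamma r) r v) (gball (cayley S) r 1%g) (@psi r v).
Hypothesis psi_root : forall r v, v \in V0 r -> @psi r v v = 1%g.
Hypothesis linA : linear_operator D A.
Hypothesis D0D : @D0 R G `<=` D.
Hypothesis A_inv : forall x y z : G,
  matrix_element A x y = matrix_element A (x * z)%g (y * z)%g.

Local Notation ar r :=
  (approx_element (matrix_element A) r (Gamma r) (V0 r) (@psi r)).
Local Notation pull r v := (pullback (gball (Gamma r) r v) (@psi r v)).
Local Notation Ar r := (kernel_op (ar r)).

Lemma D0_delta z : @D0 R G (delta R z).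
Proof.
exists [:: z], (fun _ => 1); apply/funext => y.
by rewrite big_seq1 mul1r.
Qed.

Lemma pull_inj r v : v \in V0 r -> forall x y, gball (Gamma r) r v x ->
  gball (Gamma r) r v y -> @psi r v x = @psi r v y -> x = y.
Proof. by move=> vV0 x y; exact: (psi_inj (@psi_iso r) vV0). Qed.

Lemma l2norm_pull r v (f : G -> R[i]) :
  v \in V0 r -> ell2 f -> l2norm (pull r v f) <= l2norm f.
Proof. by move=> vV0; apply: l2norm_pullback; exact: pull_inj. Qed.

Lemma pull_root r v : v \in V0 r -> pull r v (delta R 1%g) = delta R v.
Proof.
move=> vV0; apply: pullback_delta; [exact: pull_inj|exact: gball_center|].
exact: psi_root.
Qed.

(* The two functions agree on the (r / 3)-ball around v.  Off it, the left one
   is either 0 or equal to the right one, which is small there, because psi maps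
   the remaining points injectively into the tail of A delta_z. *)
Lemma transport_delta z e : 0 < e -> exists r0, forall r v, (r0 <= r)%N ->
  v \in V0 r ->
  l2norm (Ar r (pull r v (delta R z)) - pull r v (A (delta R z))) <= e.
Proof.
move=> e0; set u := A (delta R z).
have lu : ell2 u := linop_ell2r linA (D0D (D0_delta z)).
have [F hF] := ell2_tail lu (exprn_gt0 2 e0).
have gen x : exists w, all (fun s => s \in S) w /\
    x = foldr (fun s y => (s * y)%g) 1%g w.
  by case: S_gen => _ /(_ x)[w wS xw]; exists w.
have [word wordP] := choice gen.
(* Bounds the word lengths of [z] and of all points of [F], so that for r >= 3 n they have preimages
   in the ball of radius [r %/ 3]. *)
pose n := (\max_(y <- z :: F) size (word y))%N.
have lift r v y : (3 * n <= r)%N -> v \in V0 r -> y \in z :: F ->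
    exists2 x, gball (Gamma r) (r %/ 3) v x & @psi r v x = y.
  move=> nr vV0 yF; have [wS yw] := wordP y.
  have wn : (size (word y) <= r %/ 3)%N.
    rewrite leq_divRL// mulnC; apply: leq_trans nr; rewrite leq_mul2l /=.
    by rewrite /n (big_rem y yF) /= leq_maxl.
  have [x vx px] := psi_lift (@psi_iso r) (@psi_root r) vV0 wS
    (leq_trans wn (leq_div r 3)).
  by exists x; [exact: gball_le vx|rewrite px -yw].
exists (3 * n)%N => r v nr vV0.
have [y vy py] := lift r v z nr vV0 (mem_head _ _).
have r3 := leq_div r 3; have vyr := gball_le r3 vy.
rewrite (pullback_delta R (pull_inj vV0) vyr py).
have uE x : u (@psi r v x) = matrix_element A (@psi r v x) (@psi r v y).
  by rewrite /matrix_element dot_delta py.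
rewrite -(@ler_pXn2r _ 2) ?nnegrE ?l2norm_ge0 ?(ltW e0)// l2norm_fin.
(* The annulus, the only place where the two functions can differ. *)
pose far := [seq x <- index_enum (V r) | (x \in gball (Gamma r) r v)
  && (x \notin gball (Gamma r) (r %/ 3) v)].
have [|x|s' [us' s'E e']] := @pullback_sum _ _ _ (gball (Gamma r) r v) (@psi r v) (pull_inj vV0) far u.
- by rewrite filter_uniq// index_enum_uniq.
- by rewrite mem_filter => /andP[/andP[/set_mem]].
apply: (@le_trans _ _ (\sum_(x <- far) abs2 (pull r v u x))); last first.
  (* A far point with image in [F] would, by injectivity, equal the preimage of that image in the
     smaller ball. *)
  rewrite e'; apply: hF => // x'; rewrite s'E => /mapP[x].
  rewrite mem_filter => /andP[/andP[/set_mem vx /negP nx] _] ->.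
  apply/negP => xF; apply: nx; apply: mem_set.
  have [|x2 vx2 px2] := lift r v (@psi r v x) nr vV0; first by rewrite inE xF orbT.
  by rewrite -(pull_inj vV0 (gball_le r3 vx2) vx px2).
rewrite big_filter [leRHS]big_mkcond /=; apply: ler_sum => x _.
rewrite -[X in abs2 X]/(Ar r (delta R y) x - pull r v u x) kernel_op_delta.
rewrite /pullback; case: (boolP (x \in gball (Gamma r) r v)) => /= [/set_mem vx|nx].
  case: ifPn => [_|]; last first.
    rewrite negbK => /set_mem vx3.
    by rewrite (approx_element_near (@psi_iso r) A_inv vV0 vx3 vy) uE subrr abs2_0.
  have [->|[_ ->]] := approx_element_far (@psi_iso r) A_inv x vV0 vy.
    by rewrite sub0r /abs2; case: (u _) => ? ? /=; rewrite !sqrrN.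
  by rewrite uE subrr abs2_0 abs2_ge0.
have [->|[/mem_set vx _]] := approx_element_far (@psi_iso r) A_inv x vV0 vy.
  by rewrite subrr abs2_0.
by rewrite vx in nx.
Qed.

(** Linearity extends the estimate from delta functions, the threshold being the maximum over the
    finitely many terms. *)
Lemma transport_D0 h e : D0 h -> 0 < e -> exists r0, forall r v, (r0 <= r)%N ->
  v \in V0 r ->
  l2norm (Ar r (pull r v h) - pull r v (A h)) <= e.
Proof.
move=> [s [c ->]] e0.
have -> : (fun y => \sum_(x <- s) c x * delta R x y) = \sum_(x <- s) c x *: delta R x.
  by apply/funext => y; rewrite fct_sumE.
have Dd x : D (delta R x) by apply: D0D; exact: D0_delta.
have Dcd x : D (c x *: delta R x) by exact: (linopZ linA _ (Dd x)).1.
elim: s e e0 => [|x s IH] e e0.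
  exists 0%N => r v _ _; rewrite !big_nil (linop0 linA) !linear0.
  by rewrite addr0 l2norm0 ltW.
(* The summand 1 keeps the divisor positive when [c x] is 0. *)
pose K := Num.sqrt (abs2 (c x)) + 1.
have K0 : 0 < K by rewrite ltr_wpDl// sqrtr_ge0.
have [r1 h1] := transport_delta x (divr_gt0 (divr_gt0 e0 (ltr0Sn R 1)) K0).
have [r2 h2] := IH _ (divr_gt0 e0 (ltr0Sn R 1)).
exists (maxn r1 r2) => r v; rewrite geq_max => /andP[rr1 rr2] vV0.
have [Ds As] := linop_sum linA s Dcd.
rewrite !big_cons (linopD linA (Dcd x) Ds).2 (linopZ linA _ (Dd x)).2.
have linp f f' : pull r v (c x *: f + f') = c x *: pull r v f + pull r v f'.
  exact: linearP.
have linA' f f' : Ar r (c x *: f + f') = c x *: Ar r f + Ar r f' by exact: linearP.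
rewrite !linp linA' opprD addrACA -scalerBr.
apply: le_trans (l2normD (ell2_fin _) (ell2_fin _)) _.
rewrite (splitr e); apply: lerD; last exact: h2.
rewrite l2normZ; last exact: ell2_fin.
apply: (@le_trans _ _ (K * (e / 2 / K))); last by rewrite mulrC divfK// gt_eqF.
apply: ler_pM; rewrite ?sqrtr_ge0 ?l2norm_ge0 ?lerDl//.
exact: h1.
Qed.

(** The left side is the copy of (A - t) h up to the transport error, and copying does not increase
    norms. *)
Lemma transport_residual h t e : D0 h -> 0 < e ->
  exists r0, forall r v, (r0 <= r)%N -> v \in V0 r ->
  l2norm (Ar r (pull r v h) - (t%:C)%C *: pull r v h)
    <= l2norm (A h - (t%:C)%C *: h) + e.
Proof.
move=> D0h e0; have [r0 hr] := transport_D0 D0h e0; exists r0 => r v rr vV0.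
have Dh := D0D D0h.
have lu : ell2 (A h - (t%:C)%C *: h).
  by apply: ell2B; [exact: linop_ell2r linA _ Dh|apply: ell2Z; exact: linop_ell2 linA _ Dh].
have -> : Ar r (pull r v h) - (t%:C)%C *: pull r v h
    = pull r v (A h - (t%:C)%C *: h) + (Ar r (pull r v h) - pull r v (A h)).
  have -> : pull r v (A h - (t%:C)%C *: h) = pull r v (A h) - (t%:C)%C *: pull r v h.
    by rewrite linearB linearZ.
  by rewrite [RHS]addrC addrA subrK.
apply: le_trans (l2normD (ell2_fin _) (ell2_fin _)) _.
by apply: lerD; [exact: l2norm_pull|exact: hr].
Qed.

End Transport.

(** * Eigenvalues of Hermitian kernels *)

(** Identifies the list of roots chosen in [eigenvalues] with the diagonal of a diagonalisation;
    common linear factors are cancelled one at a time. *)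
Lemma prod_XsubC_perm (F : fieldType) (s t : seq F) :
  \prod_(z <- s) ('X - z%:P) = \prod_(z <- t) ('X - z%:P) -> perm_eq s t.
Proof.
elim: s t => [|x s IH] t st.
  have := congr1 (fun p : {poly F} => size p) st.
  by rewrite !size_prod_XsubC => -[/esym/size0nil ->].
have xt : x \in t by rewrite -root_prod_XsubC -st root_prod_XsubC mem_head.
rewrite perm_sym; apply: perm_trans (perm_to_rem xt) _.
rewrite perm_cons perm_sym; apply: IH.
move: st; rewrite (perm_big _ (perm_to_rem xt)) /= !big_cons.
by apply: mulfI; rewrite polyXsubC_eq0.
Qed.

Lemma char_poly_conj (F : comNzRingType) n (Q M P : 'M[F]_n) : P *m Q = 1%:M ->
  char_poly (Q *m M *m P) = char_poly M.
Proof.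
move=> PQ; have QP := mulmx1C PQ; rewrite /char_poly.
have -> : char_poly_mx (Q *m M *m P)
    = map_mx polyC Q *m char_poly_mx M *m map_mx polyC P.
  rewrite /char_poly_mx mulmxBr mulmxBl !map_mxM; congr (_ - _).
  by rewrite scalar_mxC -mulmxA -map_mxM QP map_mx1 mulmx1.
rewrite !det_mulmx mulrAC -det_mulmx -map_mxM QP map_mx1 det1 mul1r.
by [].
Qed.

Lemma abs2_conjC (R : realType) (z : R[i]) : (abs2 z)%:C%C = z * z^*.
Proof. by rewrite -normCK -add_Re2_Im2. Qed.

Section HermitianKernels.
Local Open Scope sesquilinear_scope.
Variables (R : realType) (V : finType) (k : V -> V -> R[i]).
Hypothesis k_conj : forall x y, conjc (k x y) = k y x.

(** The spectral theorem M = P^-1 D P with P unitary, in coordinates: [U i] is row i of P, the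
    conjugate of a unit eigenvector, so that the sum of [U i x * h x] is the i-th coordinate of
    [h]. *)
Lemma hermitian_kernel_diag : exists (d : 'I_#|V| -> R) (U : 'I_#|V| -> V -> R[i]),
  [/\ forall l : R, count (fun z => z <= l%:C%C) (eigenvalues (kernel_mx k))
        = #|[pred i | d i <= l]|,
      forall h i, \sum_x U i x * kernel_op k h x = (d i)%:C%C * \sum_x U i x * h x,
      forall h, \sum_i abs2 (\sum_x U i x * h x) = \sum_x abs2 (h x)
    & forall i, \sum_x abs2 (U i x) = 1].
Proof.
set M := kernel_mx k.
have hermM : M \is hermsymmx.
  apply/is_hermitianmxP; rewrite expr0 scale1r; apply/matrixP => i j.
  by rewrite !mxE -k_conj.
have := hermitian_spectral_diag_real hermM.
have /orthomx_spectralP := hermitian_normalmx hermM.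
have := spectral_unitarymx M.
move: (spectralmx M) (spectral_diag M) => P D Pu ME Dreal.
have DE i : D 0 i = (complex.Re (D 0 i))%:C%C.
  by rewrite RRe_real//; exact: (mxOverP Dreal).
pose col (h : V -> R[i]) : 'cV[R[i]]_#|V| := \col_i h (enum_val i).
have colE h i : (P *m col h) i 0 = \sum_x P i (enum_rank x) * h x.
  rewrite mxE (reindex (@enum_rank V)) /=; last by apply: onW_bij; exact: enum_rank_bij.
  by apply: eq_bigr => x _; rewrite mxE enum_rankK.
have PP : P^t* *m P = 1%:M by rewrite -invmx_unitary// mulVmx// unitarymx_unit.
exists (fun i => complex.Re (D 0 i)), (fun i x => P i (enum_rank x)); split.
- move=> l; rewrite /eigenvalues; case: closed_field_poly_normal => s /= sE.
  have : perm_eq s [seq D 0 i | i <- index_enum 'I_#|V|].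
    apply: prod_XsubC_perm; rewrite big_map.
    have := sE; rewrite (monicP (char_poly_monic M)) scale1r => <-.
    rewrite ME char_poly_conj ?mulmxV ?unitarymx_unit//.
    rewrite char_poly_trig ?diag_mx_is_trig//.
    by apply: eq_bigr => i _; rewrite !mxE eqxx mulr1n.
  move=> /permP ->; rewrite count_map -sum1_count -[RHS]sum1_card.
  by apply: eq_bigl => i; rewrite /= inE {1}DE lecR.
- move=> h i; rewrite -!colE -DE.
  have -> : col (kernel_op k h) = M *m col h.
    apply/colP => j; rewrite !mxE /kernel_op (reindex (@enum_val V predT)) /=.
      by apply: eq_bigr => x _; rewrite !mxE.
    by apply: onW_bij; exact: enum_val_bij.
  rewrite {1}ME !mulmxA mulmxV ?unitarymx_unit// mul1mx -mulmxA.
  by rewrite mul_diag_mx mxE.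
(* Preservation of norms is P^* P = 1; the unit rows in the next item come from P P^* = 1. *)
- move=> h; apply: (@complexI R); rewrite !rmorph_sum /=.
  have sumE (v : 'cV[R[i]]_#|V|) : \sum_i (abs2 (v i 0))%:C%C = (v^t* *m v) 0 0.
    by rewrite mxE; apply: eq_bigr => i _; rewrite abs2_conjC !mxE mulrC.
  under eq_bigr do rewrite -colE.
  rewrite sumE trmx_mul map_mxM mulmxA -[_ *m P]mulmxA PP mulmx1 -sumE.
  rewrite (reindex (@enum_rank V)) /=; last by apply: onW_bij; exact: enum_rank_bij.
  by apply: eq_bigr => x _; rewrite mxE enum_rankK.
- move=> i; apply: (@complexI R); rewrite !rmorph_sum /=.
  transitivity ((P *m P^t*) i i); last by rewrite (unitarymxP Pu) mxE eqxx.
  rewrite mxE [RHS](reindex (@enum_rank V)) /=; last by apply: onW_bij; exact: enum_rank_bij.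
  by apply: eq_bigr => x _; rewrite abs2_conjC !mxE.
Qed.

End HermitianKernels.

(** * Spectral projections of a Hermitian kernel *)

Section SpectralWindow.
Variables (R : realType) (V : finType) (k : V -> V -> R[i]) (n : nat).
Variables (d : 'I_n -> R) (U : 'I_n -> V -> R[i]).
Hypothesis U_eigen : forall h i,
  \sum_x U i x * kernel_op k h x = (d i)%:C%C * \sum_x U i x * h x.
Hypothesis U_isometry : forall h, \sum_i abs2 (\sum_x U i x * h x) = \sum_x abs2 (h x).
Hypothesis U_unit : forall i, \sum_x abs2 (U i x) = 1.
Variable I : pred 'I_n.

(** The spectral projection onto the eigenvectors indexed by [I], written in eigenvector
    coordinates. *)
Definition window (h : V -> R[i]) : 'I_n -> R[i] :=
  fun i => if I i then \sum_x U i x * h x else 0.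

Lemma window_is_linear : linear window.
Proof.
move=> c f h; apply/funext => i; rewrite /window -[RHS]/(c * _ + _).
case: ifP => _; last by rewrite mulr0 addr0.
rewrite mulr_sumr -big_split /=; apply: eq_bigr => x _.
by rewrite -[(c *: f + h) x]/(c * f x + h x); ring.
Qed.

HB.instance Definition _ :=
  GRing.isLinear.Build R[i] (V -> R[i]) ('I_n -> R[i]) _ window window_is_linear.

Lemma l2norm_window h : l2norm (window h) <= l2norm h.
Proof.
rewrite -(@ler_pXn2r _ 2) ?nnegrE ?l2norm_ge0// !l2norm_fin -U_isometry.
apply: ler_sum => i _; rewrite /window; case: ifP => // _.
by rewrite abs2_0 abs2_ge0.
Qed.

(** In coordinate [i], the operator minus [t] multiplies by [d i - t], whose modulus is at least
    [gap] on [I]. *)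
Lemma window_gap (t gap : R) h : 0 < gap -> (forall i, I i -> gap <= `|d i - t|) ->
  l2norm (window h) <= l2norm (kernel_op k h - (t%:C)%C *: h) / gap.
Proof.
move=> g0 gapI; rewrite ler_pdivlMr// mulrC.
rewrite -(ger0_norm (ltW g0)) -l2normZr; last exact: ell2_fin.
apply: le_trans (l2norm_window _).
rewrite -(@ler_pXn2r _ 2) ?nnegrE ?l2norm_ge0// !l2norm_fin.
apply: ler_sum => i _; rewrite -[X in abs2 X <= _]/(_ * _) abs2M abs2_real /window.
case: ifPn => Ii; last by rewrite abs2_0 mulr0.
have -> : \sum_x U i x * (kernel_op k h - (t%:C)%C *: h) x
    = (d i - t)%:C%C * \sum_x U i x * h x.
  rewrite rmorphB mulrBl -U_eigen mulr_sumr -sumrB; apply: eq_bigr => x _.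
  by rewrite -[(kernel_op k h - _) x]/(kernel_op k h x - t%:C%C * h x); ring.
rewrite abs2M abs2_real; apply: ler_wpM2r; first exact: abs2_ge0.
rewrite -(real_normK (num_real (d i - t))).
by apply: lerXn2r; rewrite ?nnegrE ?(ltW g0)// gapI.
Qed.

(** The trace of the projection is its rank: after exchanging the sums, each index in [I]
    contributes the squared norm of [U i]. *)
Lemma sum_window : \sum_x l2norm (window (delta R x)) ^+ 2 = #|I|%:R.
Proof.
have -> : \sum_x l2norm (window (delta R x)) ^+ 2
    = \sum_x \sum_i abs2 (window (delta R x) i).
  by apply: eq_bigr => x _; rewrite l2norm_fin.
rewrite exchange_big /= -sum1_card natr_sum [RHS]big_mkcond /=.
apply: eq_bigr => i _; rewrite -[in RHS]topredE /=.
rewrite /window; case: ifP => _; last first.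
  by rewrite big1// => x _; rewrite abs2_0.
rewrite -(U_unit i); apply: eq_bigr => x _.
rewrite (bigD1 x)//= big1 => [|y yx]; first by rewrite /delta eqxx mulr1 addr0.
by rewrite /delta (negbTE yx) mulr0.
Qed.

(** Write the delta function as the pieces plus a remainder; the contraction bound handles the
    remainder, and [window_gap] each piece with its own [t j]. *)
Lemma window_pieces x m (t : nat -> R) (h : nat -> V -> R[i]) (gap : R) :
  0 < gap -> (forall j i, I i -> gap <= `|d i - t j|) ->
  l2norm (window (delta R x)) <= l2norm (delta R x - \sum_(j < m) h j)
    + (\sum_(j < m) l2norm (kernel_op k (h j) - (t j)%:C%C *: h j)) / gap.
Proof.
move=> g0 gapI.
have -> : window (delta R x) = window (delta R x - \sum_(j < m) h j)
    + \sum_(j < m) window (h j).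
  by rewrite -linear_sum -linearD subrK.
apply: le_trans (l2normD (ell2_fin _) (ell2_fin _)) _.
apply: lerD; first exact: l2norm_window.
apply: le_trans (l2norm_sum _ _) _; first by move=> j; exact: ell2_fin.
rewrite mulr_suml; apply: ler_sum => j _.
by apply: window_gap => // i; exact: gapI.
Qed.

(** Vertices outside [V0] contribute at most 1 each to the trace, and at most a proportion [e] of
    the vertices lies there. *)
Lemma window_card (V0 : {set V}) (q e : R) :
  (0 < #|V|)%N -> (1 - e) * #|V|%:R <= #|V0|%:R -> 0 <= q ->
  (forall x, x \in V0 -> l2norm (window (delta R x)) <= q) ->
  #|I|%:R / #|V|%:R <= q ^+ 2 + e.
Proof.
move=> Vp V0e q0 V0q; rewrite ler_pdivrMr ?ltr0n// -sum_window.
rewrite (bigID (mem V0)) /=.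
have h1 : \sum_(x in V0) l2norm (window (delta R x)) ^+ 2 <= q ^+ 2 * #|V0|%:R.
  rewrite -sum1_card natr_sum mulr_sumr; apply: ler_sum => x xV0.
  by rewrite mulr1; apply: lerXn2r; rewrite ?nnegrE ?l2norm_ge0// V0q.
have h2 : \sum_(x | x \notin V0) l2norm (window (delta R x)) ^+ 2 <= #|~: V0|%:R.
  rewrite -sum1_card natr_sum.
  rewrite [leRHS](eq_bigl (fun x => x \notin V0)) => [|x]; last by rewrite inE.
  apply: ler_sum => x _; rewrite expr_le1 ?l2norm_ge0//.
  by apply: le_trans (l2norm_window _) _; rewrite l2norm_delta.
have h3 : #|~: V0|%:R = #|V|%:R - #|V0|%:R :> R.
  by rewrite -(cardsC V0) natrD addrC addKr.
have h4 : q ^+ 2 * #|V0|%:R <= q ^+ 2 * #|V|%:R.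
  by apply: ler_wpM2l; rewrite ?sqr_ge0// ler_nat max_card.
lra.
Qed.

End SpectralWindow.

Lemma dot_delta_r (R : realType) (T : choiceType) (f : T -> R[i]) (x : T) :
  dot f (delta R x) = conjc (f x).
Proof.
rewrite /dot /csum; pose u y := conjc (f y) * delta R x y; rewrite -/u.
have u0 y : y != x -> u y = 0 by move=> yx; rewrite /u /delta (negbTE yx) mulr0.
have ux : u x = conjc (f x) by rewrite /u /delta eqxx mulr1.
rewrite (@rsum_single _ _ x (fun y => complex.Re (u y))); last by move=> y /u0 ->.
rewrite (@rsum_single _ _ x (fun y => complex.Im (u y))); last by move=> y /u0 ->.
by rewrite ux; case: (f x).
Qed.

(** Symmetry of [A] on delta functions, which makes the kernels of the A_r Hermitian. *)
Lemma matrix_element_conj (R : realType) (T : choiceType) (D : set (T -> R[i])) A :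
  self_adjoint D A -> (forall x, D (delta R x)) ->
  forall x y, conjc (matrix_element A x y) = matrix_element A y x.
Proof.
move=> [linA _ sa] Dd x y; rewrite /matrix_element dot_delta -dot_delta_r.
apply: (proj2 (sa (delta R x) (A (delta R x)) (ell2_delta _ x) (linop_ell2r linA (Dd x)))) => //.
Qed.

(** * Convergence of the eigenvalue counting functions *)

Section HalflineBound.
Variables (R : realType) (G : groupType) (S : {fset G}).
Variable eps : nat -> R.
Variables (V : nat -> finType) (Gamma : forall r, ldigraph (V r) G).
Variables (V0 : forall r, {set V r}) (psi : forall r, V r -> V r -> G).
Variables (D : set (G -> R[i])) (A : (G -> R[i]) -> (G -> R[i])).
Variable E : set (measurableTypeR R) -> (G -> R[i]) -> (G -> R[i]).
Hypothesis S_gen : symmetric_generating S.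
Hypothesis Gamma_approx :
  forall r, sofic_approximation S (eps r) r (Gamma r) (V0 r).
Hypothesis psi_iso : forall r v, v \in V0 r ->
  labeled_iso (Gamma r) (cayley S)
    (gball (Gamma r) r v) (gball (cayley S) r 1%g) (@psi r v).
Hypothesis psi_root : forall r v, v \in V0 r -> @psi r v v = 1%g.
Hypothesis A_sa : self_adjoint D A.
Hypothesis A_core : is_core D A (@D0 R G).
Hypothesis A_inv : forall x y z : G,
  matrix_element A x y = matrix_element A (x * z)%g (y * z)%g.
Hypothesis E_spectral : spectral_measure D A E.

Local Notation ar r :=
  (approx_element (matrix_element A) r (Gamma r) (V0 r) (@psi r)).
Local Notation pull r v := (pullback (gball (Gamma r) r v) (@psi r v)).

(** The sign [s] covers both half-lines. All points t_k are of the form [a + s * c] with [c >= 0],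
    so one gap condition serves every partition, and the threshold is uniform in the eigenvectors
    and in [I]. *)
Lemma window_halfline (B : set (measurableTypeR R)) (s a gap e : R) :
  measurable B -> (forall x, B x -> x - a = s * `|x - a|) -> `|s| <= 1 ->
  0 < gap -> 0 < e ->
  exists r0, forall r (d : 'I_#|V r| -> R) (U : 'I_#|V r| -> V r -> R[i])
    (I : pred 'I_#|V r|), (r0 <= r)%N ->
    (forall h i, \sum_x U i x * kernel_op (ar r) h x
       = (d i)%:C%C * \sum_x U i x * h x) ->
    (forall h, \sum_i abs2 (\sum_x U i x * h x) = \sum_x abs2 (h x)) ->
    (forall i, \sum_x abs2 (U i x) = 1) ->
    (forall c i, 0 <= c -> I i -> gap <= `|d i - (a + s * c)|) ->
    #|I|%:R / #|V r|%:R <= 1 - mass E (delta R 1%g) B + e + eps r.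
Proof.
move=> mB Bs s1 g0 e0.
have pvmE : projection_valued_measure E by case: E_spectral.
have linA : linear_operator D A by case: A_sa.
have D0D : @D0 R G `<=` D by case: A_core.
have ld := ell2_delta R (1%g : G).
have d1 : ip (delta R (1%g : G)) (delta R 1%g) = 1.
  by rewrite -l2norm2 l2norm_delta expr1n.
pose M := mass E (delta R 1%g) B.
have M0 : 0 <= M by exact: mass_ge0.
have M1 : M <= 1 by rewrite -d1 -(massT pvmE ld); exact: le_mass.
(* Makes the error y below satisfy 2 y + y^2 <= e. *)
pose e1 := Num.min 1 (e / 3) / (1 + 2 / gap).
have c0 : 0 < 1 + 2 / gap by rewrite addr_gt0// divr_gt0.
have e10 : 0 < e1 by rewrite divr_gt0// lt_min ltr01 divr_gt0.
have [m [c [h [c_ge0 hD h1 h2]]]] :=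
  halfline_pieces A_sa E_spectral A_core mB ld e10 Bs s1.
(* The finitely many pieces share one threshold; their transport errors sum to at most [e1]. *)
have [r0 hr] : exists r0, forall j, (j < m)%N -> forall r v, (r0 <= r)%N -> v \in V0 r ->
    l2norm (kernel_op (ar r) (pull r v (h j)) - (a + s * c j)%:C%C *: pull r v (h j))
      <= l2norm (A (h j) - (a + s * c j)%:C%C *: h j) + e1 / m.+1%:R.
  have em : 0 < e1 / m.+1%:R by rewrite divr_gt0.
  have [f fP] := choice (fun j => transport_residual S_gen psi_iso psi_root linA D0D A_inv
    (a + s * c j) (hD j) em).
  exists (\max_(j < m) f j)%N => j jm r v rr vV0; apply: fP => //.
  by apply: leq_trans rr; exact: (leq_bigmax (Ordinal jm)).
exists r0 => r d U I rr Ueig Uiso Uunit gapI.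
have [Vp _ _ V0e] := Gamma_approx r.
(* The first [e1] is the approximation error of [halfline_pieces]; the residuals total at most
   [2 * e1], half from that lemma and half from the transport, and are divided by [gap]. *)
pose q := Num.sqrt (1 - M) + e1 * (1 + 2 / gap).
have e1q : e1 * (1 + 2 / gap) = Num.min 1 (e / 3) by rewrite /e1 divfK// gt_eqF.
have q0 : 0 <= q by rewrite addr_ge0 ?sqrtr_ge0// mulr_ge0 ?ltW.
have qe : q ^+ 2 <= 1 - M + e.
  have m1 : Num.min 1 (e / 3) <= 1 by rewrite ge_min lexx.
  have m3 : Num.min 1 (e / 3) <= e / 3 by rewrite ge_min lexx orbT.
  have mp : 0 <= Num.min 1 (e / 3) by rewrite -e1q mulr_ge0 ?ltW.
  rewrite /q e1q; move: (Num.min _ _) m1 m3 mp => y y1 y3 y0.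
  have sM : Num.sqrt (1 - M) ^+ 2 = 1 - M by rewrite sqr_sqrtr// subr_ge0.
  have s_le1 : Num.sqrt (1 - M) <= 1.
    by rewrite -[leRHS]sqrtr1; apply: ler_wsqrtr; lra.
  have := ler_wpM2r y0 s_le1; have := ler_wpM2r y0 y1.
  by rewrite sqrrD sM expr2; lra.
apply: le_trans (lerD qe (lexx (eps r))).
apply: (window_card Uiso Uunit Vp V0e q0) => v vV0.
apply: le_trans (window_pieces (t := fun j => a + s * c j) Ueig Uiso
  v m (fun j => pull r v (h j)) g0 _) _.
  by move=> j i; exact: gapI.
rewrite /q mulrDr mulr1 addrA; apply: lerD.
  rewrite d1 in h1; apply: le_trans h1.
  have -> : delta R v - \sum_(j < m) pull r v (h j)
      = pull r v (delta R 1%g - \sum_(j < m) h j).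
    by rewrite linearB /= (pull_root R psi_iso psi_root)//; congr (_ - _); rewrite linear_sum.
  apply: (l2norm_pull psi_iso) => //; apply: ell2B => //.
  by apply: ell2_sum => j; exact: (linop_ell2 linA (D0D _ (hD j))).
rewrite mulrA; apply: ler_wpM2r; first by rewrite invr_ge0 ltW.
apply: le_trans (ler_sum _ (fun (j : 'I_m) _ => hr j (ltn_ord j) r v rr vV0)) _.
rewrite big_split /= mulr2n mulrDr mulr1; apply: lerD => //.
rewrite sumr_const card_ord -[leLHS]mulr_natr mulrAC ler_pdivrMr//.
by rewrite ler_pM2l// ler_nat.
Qed.

End HalflineBound.

Theorem theorem2p4 (R : realType) (G : groupType) (S : {fset G})
    (eps : nat -> R) (V : nat -> finType) (Gamma : forall r, ldigraph (V r) G)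
    (V0 : forall r, {set V r}) (psi : forall r, V r -> V r -> G)
    (D : set (G -> R[i])) (A : (G -> R[i]) -> (G -> R[i]))
    (E : set (measurableTypeR R) -> (G -> R[i]) -> (G -> R[i]))
    (S_gen : symmetric_generating S)
    (G_sofic : @sofic R G S)
    (eps_gt0 : forall r, 0 < eps r)
    (eps_cvg0 : eps @ \oo --> 0)
    (Gamma_approx : forall r, sofic_approximation S (eps r) r (Gamma r) (V0 r))
    (psi_iso : forall r v, v \in V0 r ->
       labeled_iso (Gamma r) (cayley S)
         (gball (Gamma r) r v) (gball (cayley S) r 1%g) (psi r v))
    (psi_root : forall r v, v \in V0 r -> psi r v v = 1%g)
    (A_sa : self_adjoint D A)
    (A_core : is_core D A (@D0 R G))
    (A_inv : forall x y z : G,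
       matrix_element A x y = matrix_element A (x * z)%g (y * z)%g)
    (E_spectral : spectral_measure D A E)
    (lambda : R)
    (lambda_cont : {for lambda, continuous (spectral_distribution E)}) :
  eigenvalue_counting
    (approx_element (matrix_element A) r (Gamma r) (V0 r) (psi r)) lambda
    @[r --> \oo] --> spectral_distribution E lambda.
Proof.
have pvmE : projection_valued_measure E by case: E_spectral.
have ld := ell2_delta R (1%g : G).
have d1 : ip (delta R (1%g : G)) (delta R 1%g) = 1.
  by rewrite -l2norm2 l2norm_delta expr1n.
pose le_set (x : R) : set (measurableTypeR R) := [set t | t <= x].
have mle x : measurable (le_set x).
  rewrite (_ : le_set x = [set` `]-oo, x]]); first exact: measurable_itv.
  by apply/seteqP; split => t; rewrite /= in_itv.
have NE x : spectral_distribution E x = mass E (delta R 1%g) (le_set x).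
  by rewrite /spectral_distribution re_dot (pvm_ip pvmE (mle x) ld).
apply/cvgrPdist_lt => e e0.
have e30 : 0 < e / 3 by rewrite divr_gt0.
have [rho rho0 near_lambda] : exists2 rho, 0 < rho &
    forall x, `|lambda - x| <= rho ->
      `|spectral_distribution E lambda - spectral_distribution E x| < e / 3.
  have /cvgrPdist_lt /(_ _ e30) /nbhs_ballP[rho /= rho0 h] := lambda_cont.
  (* Halved, since the ball given by continuity is open and the bound is wanted at distance [rho]
     itself. *)
  exists (rho / 2); first by rewrite divr_gt0.
  by move=> x xr; apply: h; rewrite /ball /=; apply: le_lt_trans xr _; lra.
(* Spectral mass above [lambda + rho] limits the eigenvalues up to [lambda]. *)
have mgt := measurableC (mle (lambda + rho)).
have [||r1 up] := window_halfline (B := ~` le_set (lambda + rho)) (s := 1)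
  (a := lambda + rho) S_gen Gamma_approx psi_iso psi_root A_sa A_core A_inv E_spectral
  mgt _ _ rho0 e30.
- move=> x /= /negP; rewrite -ltNge => xl.
  by rewrite mul1r ger0_norm// subr_ge0 ltW.
- by rewrite normr1.
(* Spectral mass up to [lambda - rho] limits the eigenvalues above [lambda]. *)
have [||r2 lo] := window_halfline (B := le_set (lambda - rho)) (s := -1)
  (a := lambda - rho) S_gen Gamma_approx psi_iso psi_root A_sa A_core A_inv E_spectral
  (mle _) _ _ rho0 e30.
- by move=> x /= xl; rewrite mulN1r ler0_norm ?opprK// subr_le0.
- by rewrite normrN1.
have /cvgrPdist_lt /(_ _ e30) [r3 _ small_eps] := eps_cvg0.
exists (maxn r1 (maxn r2 r3)) => // r /=.
rewrite !geq_max => /and3P[rr1 rr2 rr3].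
have Dd x : D (delta R x) by case: A_core => + _; apply; exact: D0_delta.
have [d [U [countE Ueig Uiso Uunit]]] := hermitian_kernel_diag
  (fun x y => approx_element_conj r (Gamma r) (V0 r) (psi r) x y
     (matrix_element_conj A_sa Dd)).
have [Vp _ _ _] := Gamma_approx r.
rewrite /eigenvalue_counting countE.
have := small_eps r rr3; rewrite /= sub0r normrN gtr0_norm// => er.
have := up r d U [pred i | d i <= lambda] rr1 Ueig Uiso Uunit.
have := lo r d U [pred i | ~~ (d i <= lambda)] rr2 Ueig Uiso Uunit.
have -> : mass E (delta R 1%g) (~` le_set (lambda + rho))
    = 1 - spectral_distribution E (lambda + rho).
  rewrite NE -d1 -(massT pvmE ld) -(setUv (le_set (lambda + rho))) massU//.
    by rewrite [RHS]addrC addKr.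
  by rewrite setICr.
rewrite -NE {lambda_cont}.
move: (spectral_distribution E) {NE} near_lambda => N near_lambda hlo hup.
have := near_lambda (lambda + rho); have := near_lambda (lambda - rho).
rewrite !opprD !addrA opprK subrr !add0r normrN (ger0_norm (ltW rho0)).
move=> /(_ (lexx _)) n1 /(_ (lexx _)) n2.
(* Complementary proportions turn the bound on eigenvalues above [lambda] into a lower bound on
   N_r(lambda). *)
have cc : #|[pred i | d i <= lambda]|%:R / #|V r|%:R
    + #|[pred i | ~~ (d i <= lambda)]|%:R / #|V r|%:R = 1 :> R.
  rewrite -mulrDl -natrD.
  have -> : (#|[pred i | (d i <= lambda)%R]| + #|[pred i | ~~ (d i <= lambda)%R]|)%N = #|V r|.
    by rewrite -[RHS]card_ord -(cardC [pred i | d i <= lambda]).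
  by rewrite divff// pnatr_eq0 -lt0n.
have h1 : #|[pred i | d i <= lambda]|%:R / #|V r|%:R
    <= 1 - (1 - N (lambda + rho)) + e / 3 + eps r.
  apply: hup => c i c0 /= dl; rewrite mul1r ler0_norm; lra.
have h2 : #|[pred i | ~~ (d i <= lambda)]|%:R / #|V r|%:R
    <= 1 - N (lambda - rho) + e / 3 + eps r.
  apply: hlo => c i c0 /=; rewrite -ltNge => dl; rewrite ger0_norm; lra.
(* Three errors below or equal to e / 3: continuity of N, the loss in [window_halfline], and
   [eps r]. *)
move: n1 n2; rewrite !ltr_norml => /andP[n1 n1'] /andP[n2 n2'].
by apply/andP; split; lra.
Qed.
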